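(* Let $M\ge 1$ be an integer. For any $x>0$ and any $q\in(1,q_x]\setminus\overline{\mathcal{U}}$ we have $$\lim_{\delta\to 0}\dim_H\big(\mathcal{U}(x)\cap(q-\delta,q+\delta)\big)=\lim_{\delta\to 0}\dim_H\big(\mathcal{U}_q\cap(x-\delta,x+\delta)\big),$$ where $\mathcal{U}(x)$ is the set of univoque bases of $x$, $\mathcal{U}_q$ is the set of points with a unique $q$-expansion, and $\overline{\mathcal{U}}$ is the closure of $\mathcal{U}=\mathcal{U}(1)$.
   Context: For $q\in(1,M+1]$ and $x\ge 0$, a $q$-expansion of $x$ is a sequence $(d_i)_{i\ge1}\in\{0,1,\ldots,M\}^{\mathbb{N}}$ with $x=\sum_{i=1}^\infty d_i q^{-i}$ (every $x\in[0,M/(q-1)]$ has at least one). Let $\mathcal{U}_q$ be the set of $x\in[0,M/(q-1)]$ having exactly one $q$-expansion. For $x\ge 0$ let $\mathcal{U}(x):=\{q\in(1,M+1]: x\in\mathcal{U}_q\}$, and $\mathcal{U}:=\mathcal{U}(1)$, with topological closure $\overline{\mathcal{U}}$ (in $\mathbb{R}$). For $x>0$ let $q_x:=\min\{1+M,\,1+M/x\}$. $\dim_H$ denotes Hausdorff dimension with respect to the Euclidean metric on $\mathbb{R}$; the empty set has dimension $0$. *)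

(* Defs.v *)
From mathcomp Require Import all_boot all_order all_algebra.
From mathcomp Require Import all_classical all_reals all_analysis.

Set Implicit Arguments.
Unset Strict Implicit.
Unset Printing Implicit Defensive.

Import Order.TTheory GRing.Theory Num.Theory.
Import numFieldNormedType.Exports.

Local Open Scope classical_set_scope.
Local Open Scope ring_scope.

Section HausdorffDimension.
Context {R : realType}.
Implicit Types (A : set R) (U : nat -> set R) (s e : R).

(* The 0 only matters for A = set0, where the bare supremum would be -oo. *)
Definition diam A : \bar R :=
  ereal_sup (0%E |` [set `|x - y|%:E | x in A & y in A]).

(* The empty set has weight 0 for every s, s = 0 included; a singleton has
   weight 0 `^ 0 = 1 for s = 0, so that s = 0 gives the counting measure. *)
Definition hweight s A : \bar R :=
  if A == set0 then 0%E else poweR (diam A) s.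

Definition hcover e A U : Prop :=
  A `<=` \bigcup_i U i /\ forall i, (diam (U i) <= e%:E)%E.

Definition hausdorff_premeasure s e A : \bar R :=
  ereal_inf [set (\sum_(0 <= i <oo) hweight s (U i))%E | U in hcover e A].

(* The premeasure is nonincreasing in e, so this supremum is the limit
   as e tends to 0. *)
Definition hausdorff_measure s A : \bar R :=
  ereal_sup [set hausdorff_premeasure s e A | e in [set e : R | 0 < e]].

Definition hausdorff_dim A : \bar R :=
  ereal_inf [set s%:E | s in
    [set s : R | 0 <= s /\ hausdorff_measure s A = 0%E]].

End HausdorffDimension.

Section Univoque.
Context {R : realType}.
Variable M : nat.
Implicit Types (q x : R).

(* The digit with index i of d is the (i+1)-st digit of the expansion. *)
Definition is_expansion q x (d : nat -> 'I_M.+1) : Prop :=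
  series (fun i => (d i : nat)%:R / q ^+ i.+1) @ \oo --> x.

Definition univoque_points q : set R :=
  [set x | 0 <= x <= M%:R / (q - 1) /\ exists! d, is_expansion q x d].

Definition univoque_bases x : set R :=
  [set q | 1 < q <= M%:R + 1 /\ univoque_points q x].

Definition max_base x : R := Num.min (1 + M%:R) (1 + M%:R / x).

End Univoque.

(* Main.v *)
Require Import Defs.
From mathcomp Require Import all_boot all_order all_algebra.
From mathcomp Require Import ring lra zify.
From mathcomp Require Import all_classical all_reals all_analysis.

Set Implicit Arguments.
Unset Strict Implicit.
Unset Printing Implicit Defensive.

Import Order.TTheory GRing.Theory Num.Theory.
Import numFieldNormedType.Exports.
Local Open Scope classical_set_scope.
Local Open Scope ring_scope.

(** For a digit sequence [d], call a tail of [d] (or of its reflection [M - d])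
    admissible if the digit before it can be increased. A point has the unique
    expansion [d] in base [p] iff every admissible tail of [d] has value [< 1] in base
    [p]; the set of such [d] grows with [p]. Suppose [d] is univoque in base [Q] but not
    in base [P < Q], and let [s] be the least base in which all its admissible tails
    have value [<= 1]. These tails accumulate at a sequence [e] of value [1] in base
    [s], unique because such weakly univoque sequences are separated. If [s] is not in the
    closure of the univoque bases of [1], then [e] is an admissible tail of itself,
    hence periodic, and it is also an admissible tail of [d]; otherwise [e = w^oo] could
    be perturbed to sequences [w c] univoque in bases [< s] close to [s]. So only
    countably many sequences change status near [q].

    Up to these, a base [p] near [q] in which [x] has the unique expansion [d]
    corresponds to the point [ev q d] near [x]. If the first difference of two such
    sequences is at place [n], the distances of their bases and of their points lie
    between constant multiples of [(q + delta)^-n] and [(q - delta)^-n], so that the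
    correspondence is Hoelder both ways with exponents tending to [1]. *)

(** * Values of digit sequences *)

Section Evaluation.
Context {R : realType} {M : nat}.
Implicit Types (p : R) (d c : nat -> 'I_M.+1).

Definition ev p d : R :=
  limn (series (fun i => (d i : nat)%:R / p ^+ i.+1)).

Definition shift n d : nat -> 'I_M.+1 := fun i => d (n + i)%N.

Definition refl d : nat -> 'I_M.+1 := fun i => rev_ord (d i).

(** For [1 < p], the value of the constant sequence [M], hence the largest value in base [p]. *)
Definition top p : R := M%:R / (p - 1).

Lemma shift0 d : shift 0 d = d.
Proof. by apply/funext => i; rewrite /shift add0n. Qed.

Lemma shift_shift m n d : shift m (shift n d) = shift (n + m) d.
Proof. by apply/funext => i; rewrite /shift addnA. Qed.

Lemma reflK d : refl (refl d) = d.
Proof. by apply/funext => i; rewrite /refl rev_ordK. Qed.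

Lemma refl_shift n d : refl (shift n d) = shift n (refl d).
Proof. by []. Qed.

Lemma val_refl d n : refl d n = (M - d n)%N :> nat.
Proof. by rewrite /refl /= subSS. Qed.

Lemma digit_le d n : (d n <= M)%N.
Proof. by rewrite -ltnS ltn_ord. Qed.

Lemma digitr_le d n : (d n : nat)%:R <= M%:R :> R.
Proof. by rewrite ler_nat digit_le. Qed.

Lemma refl_digitr d n : (refl d n : nat)%:R = M%:R - (d n : nat)%:R :> R.
Proof. by rewrite val_refl natrB // digit_le. Qed.

Lemma refl_gt0 d n : (0 < refl d n)%N = (d n < M)%N.
Proof. by rewrite val_refl subn_gt0. Qed.

Lemma refl_ltM d n : (refl d n < M)%N = (0 < d n)%N.
Proof. by rewrite val_refl; have := digit_le d n; lia. Qed.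

Lemma geometric_lt p (C e : R) : 1 < p -> 0 < e -> exists n, C / p ^+ n < e.
Proof.
move=> p1 e0.
have : geometric C p^-1 @ \oo --> (0 : R).
  apply: cvg_geometric; rewrite ger0_norm ?invr_ge0; last lra.
  by rewrite invf_lt1; lra.
move/cvgrPdist_lt => /(_ e e0) [n _ /(_ n (leqnn n))] /=.
rewrite sub0r normrN exprVn => h; exists n.
by apply: le_lt_trans h; rewrite ler_norm.
Qed.

Lemma geometric_squeeze p (C z : R) : 1 < p ->
  (forall n, `|z| <= C / p ^+ n) -> z = 0.
Proof.
move=> p1 h; apply/eqP; rewrite -normr_le0 leNgt; apply/negP => z0.
have [n hn] := geometric_lt C p1 z0.
by have := le_lt_trans (h n) hn; rewrite ltxx.
Qed.

Lemma ev_expansion p d : 1 < p -> is_expansion p (ev p d) d.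
Proof.
move=> p1; apply: (@series_le_cvg R _ (geometric (M%:R / p) p^-1)).
- by move=> n; rewrite divr_ge0 ?ler0n ?exprn_ge0//; lra.
- move=> n; rewrite /geometric /= mulr_ge0 ?exprn_ge0 ?invr_ge0 ?divr_ge0 ?ler0n//; lra.
- move=> n; rewrite /geometric /= exprVn -mulrA -invfM -exprS.
  by rewrite ler_wpM2r ?digitr_le// invr_ge0 exprn_ge0//; lra.
- apply: is_cvg_geometric_series; rewrite ger0_norm ?invr_ge0; last lra.
  by rewrite invf_lt1; lra.
Qed.

Lemma expansion_ev p x d : is_expansion p x d -> ev p d = x.
Proof. by move/cvg_lim; apply. Qed.

Lemma ev_rec p d : 1 < p -> ev p d = ((d 0%N : nat)%:R + ev p (shift 1 d)) / p.
Proof.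
move=> p1; apply: expansion_ev; rewrite /is_expansion -cvg_shiftS.
under eq_fun do rewrite seriesEnat /= big_nat_recl// expr1.
rewrite mulrDl; apply: cvgD; first exact: cvg_cst.
rewrite mulrC; under eq_fun do (under eq_bigr do
  rewrite exprS invfM mulrCA); under eq_fun do rewrite -mulr_sumr.
apply: cvgM; first exact: cvg_cst.
by have := @ev_expansion p (shift 1 d) p1; rewrite /is_expansion seriesEnat.
Qed.

Lemma ev_ge0 p d : 1 < p -> 0 <= ev p d.
Proof.
move=> p1; have := @ev_expansion p d p1; rewrite /is_expansion => h.
rewrite -(cvg_lim _ h)//; apply: limr_ge; first by apply/cvg_ex; exists (ev p d).
by apply: nearW => n; rewrite sumr_ge0// => i _;
  rewrite divr_ge0 ?ler0n ?exprn_ge0//; lra.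
Qed.

Lemma ev_refl p d : 1 < p -> ev p (refl d) = top p - ev p d.
Proof.
move=> p1; apply/eqP; rewrite -subr_eq opprK; apply/eqP.
have h1 : is_expansion p (ev p (refl d)) (refl d) by exact: ev_expansion.
have h2 : is_expansion p (ev p d) d by exact: ev_expansion.
have h4 : series (geometric (M%:R / p) p^-1) @ \oo --> M%:R / p / (1 - p^-1).
  apply: cvg_geometric_series; rewrite ger0_norm ?invr_ge0; last lra.
  by rewrite invf_lt1; lra.
have -> : top p = M%:R / p / (1 - p^-1).
  by rewrite /top; field; apply/andP; split; rewrite ?subr_eq0 gt_eqF//; lra.
have E : series (fun i => (refl d i : nat)%:R / p ^+ i.+1) +
    series (fun i => (d i : nat)%:R / p ^+ i.+1) = series (geometric (M%:R / p) p^-1).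
  apply/funext => n; rewrite fctE !seriesEnat /= -big_split /=.
  apply: eq_bigr => i _.
  by rewrite -mulrDl refl_digitr subrK exprVn exprS invfM mulrA.
move: h4; rewrite -E => h4; have h3 : series (fun i => (refl d i : nat)%:R / p ^+ i.+1) +
    series (fun i => (d i : nat)%:R / p ^+ i.+1) @ \oo --> ev p (refl d) + ev p d.
  exact: cvgD h1 h2.
exact: (cvg_unique _ h3 h4).
Qed.

Lemma ev_le_top p d : 1 < p -> ev p d <= top p.
Proof. by move=> p1; rewrite -subr_ge0 -ev_refl// ev_ge0. Qed.

(** The error [ev p (shift n d) - y n] is multiplied by [p] at each step, so a nonzero error would
    outgrow [top p + C]. *)
Lemma ev_orbit p d (y : nat -> R) (C : R) : 1 < p ->
  (forall n, `|y n| <= C) ->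
  (forall n, p * y n = (d n : nat)%:R + y n.+1) -> ev p d = y 0%N.
Proof.
move=> p1 yC yS; have p0 : p != 0 by rewrite gt_eqF//; lra.
pose z n := ev p (shift n d) - y n.
have zS n : z 0%N = z n / p ^+ n.
  elim: n => [|n ->]; first by rewrite expr0 divr1.
  rewrite exprS /z (ev_rec (shift n d))// shift_shift addn1 /shift addn0.
  have -> : y n = ((d n : nat)%:R + y n.+1) / p by rewrite -yS mulrC mulKf.
  field; by rewrite ?expf_neq0 ?p0.
apply/eqP; rewrite -subr_eq0; have -> : ev p d - y 0%N = z 0%N by rewrite /z shift0.
apply/eqP/(geometric_squeeze (p := p) (C := top p + C))=> // n.
rewrite (zS n) normrM normfV [`|p ^+ n|]ger0_norm ?exprn_ge0//; last lra.
rewrite ler_wpM2r ?invr_ge0 ?exprn_ge0//; first lra.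
apply: le_trans (ler_normB _ _) _; rewrite lerD//.
by rewrite ger0_norm ?ev_ge0// ev_le_top.
Qed.

Lemma ev_agree p c d n : 1 < p -> (forall i, (i < n)%N -> c i = d i) ->
  ev p c - ev p d = (ev p (shift n c) - ev p (shift n d)) / p ^+ n.
Proof.
move=> p1; elim: n => [|n IH] h; first by rewrite !shift0 expr0 divr1.
rewrite IH => [|i ni]; last by apply: h; rewrite ltnS ltnW.
rewrite (ev_rec (shift n c))// (ev_rec (shift n d))// !shift_shift addn1.
have p0 : p != 0 by rewrite gt_eqF//; lra.
by rewrite /shift !addn0 h// exprS; field; rewrite ?expf_neq0 ?p0.
Qed.

(** The extra factor cancels one power of the base; what remains is compared termwise. Unlike plain
    monotonicity of [ev], this also bounds changes of value from below. *)
Lemma ler_ev p p' d : 1 < p -> p <= p' -> p' * ev p' d <= p * ev p d.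
Proof.
move=> p1 pp'; have p'1 : 1 < p' by lra.
have h1 : is_expansion p (ev p d) d by exact: ev_expansion.
have h2 : is_expansion p' (ev p' d) d by exact: ev_expansion.
apply: (ler_cvg_to (cvgM (cvg_cst p') h2) (cvgM (cvg_cst p) h1)); apply: nearW => n /=.
rewrite !seriesEnat /= !mulr_sumr ler_sum// => i _.
rewrite !exprS mulrCA [leRHS]mulrCA ler_wpM2l ?ler0n// !invfM !mulrA.
rewrite !divff ?gt_eqF ?mul1r; try lra.
rewrite lef_pV2 ?posrE ?exprn_gt0; try lra.
by rewrite lerXn2r ?nnegrE; lra.
Qed.

Lemma ev_anti p p' d : 1 < p -> p <= p' -> ev p' d <= ev p d.
Proof.
move=> p1 pp'; have := ler_ev d p1 pp'; have := @ev_ge0 p' d.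
nra.
Qed.

(** The value of [refl d] decreases in the base too, so the value of [d] drops by at most the drop
    of [top]: the constant sequence [M] is the worst case. *)
Lemma ev_lipschitz a p p' d : 1 < a -> a <= p -> a <= p' ->
  `|ev p d - ev p' d| <= M%:R / (a - 1) ^+ 2 * `|p - p'|.
Proof.
move=> a1; wlog pp' : p p' / p <= p' => [wl ap ap'|ap ap'].
  have [pp'|/ltW pp'] := leP p p'; first exact: wl.
  by rewrite distrC [`|p - p'|]distrC; apply: wl.
have p1 : 1 < p by lra. have p'1 : 1 < p' by lra.
rewrite ger0_norm ?subr_ge0 ?ev_anti// ler0_norm ?subr_le0// opprB.
have := ev_anti (refl d) p1 pp'; rewrite !ev_refl// => h.
have {h} : ev p d - ev p' d <= top p - top p' by lra.
move=> /le_trans; apply.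
have -> : top p - top p' = M%:R / ((p - 1) * (p' - 1)) * (p' - p).
  by rewrite /top; field; rewrite !subr_eq0 !gt_eqF.
rewrite ler_wpM2r ?subr_ge0// ler_wpM2l ?ler0n// lef_pV2 ?posrE.
- by rewrite expr2 ler_pM//; lra.
- by rewrite mulr_gt0//; lra.
- by rewrite exprn_gt0//; lra.
Qed.

End Evaluation.
Arguments top {R} M p.

(** * Univoque sequences *)

Section UnivoqueSequences.
Context {R : realType} {M : nat}.
Implicit Types (p : R) (d c t : nat -> 'I_M.+1).

(** Both halves of the lexicographic criterion in one relation, which is transitive and does not
    change when [d] is reflected. *)
Definition admissible_tail d t := exists n,
  ((d n < M)%N /\ t = shift n.+1 d) \/ ((0 < d n)%N /\ t = shift n.+1 (refl d)).

Definition weakly_univoque p d := forall t, admissible_tail d t -> ev p t <= 1.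

Definition univoque p d := forall t, admissible_tail d t -> ev p t < 1.

Lemma univoqueW p d : univoque p d -> weakly_univoque p d.
Proof. by move=> h t /h /ltW. Qed.

Lemma admissible_tail_trans d t u :
  admissible_tail d t -> admissible_tail t u -> admissible_tail d u.
Proof.
move=> [n [[dn ->]|[dn ->]]] [m [[tm ->]|[tm ->]]]; exists (n.+1 + m)%N;
  rewrite ?refl_shift ?shift_shift addnS.
- by left.
- by right.
- by right; split=> //; rewrite -refl_ltM.
- by left; split; rewrite ?reflK// -refl_gt0.
Qed.

Lemma admissible_tail_refl d t :
  admissible_tail (refl d) t <-> admissible_tail d t.
Proof.
suff h c : admissible_tail (refl c) t -> admissible_tail c t.
  by split; [exact: h|rewrite -{1}[d]reflK; exact: h].
move=> [n]; rewrite refl_ltM refl_gt0 reflK.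
by case=> ?; exists n; [right|left].
Qed.

Lemma weakly_univoque_refl p d : weakly_univoque p d -> weakly_univoque p (refl d).
Proof. by move=> h t /admissible_tail_refl; apply: h. Qed.

Lemma univoque_refl p d : univoque p d -> univoque p (refl d).
Proof. by move=> h t /admissible_tail_refl; apply: h. Qed.

Lemma weakly_univoque_tail p d t :
  weakly_univoque p d -> admissible_tail d t -> weakly_univoque p t.
Proof. by move=> h dt u tu; apply: h; apply: admissible_tail_trans dt tu. Qed.

Lemma univoque_mono p p' d : 1 < p -> p <= p' -> univoque p d -> univoque p' d.
Proof. by move=> p1 pp' h t /h; apply: le_lt_trans; exact: ev_anti. Qed.

Lemma first_difference c d : c <> d ->
  exists n, (forall i, (i < n)%N -> c i = d i) /\ c n <> d n.
Proof.
move=> cd; have /ex_minnP[n ncd nmin] : exists n, c n != d n.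
  apply: contrapT => h; apply: cd; apply/funext => n; apply: contrapT => /eqP cdn.
  by apply: h; exists n.
exists n; split; last exact/eqP.
move=> i ni; apply: contrapT => /eqP /nmin; by rewrite leqNgt ni.
Qed.

Lemma ev_diff p c d n : 1 < p -> (forall i, (i < n)%N -> c i = d i) ->
  ev p c - ev p d = ((c n : nat)%:R - (d n : nat)%:R +
    (ev p (shift n.+1 c) - ev p (shift n.+1 d))) / p ^+ n.+1.
Proof.
move=> p1 h; rewrite (ev_agree p1 h) (ev_rec (shift n c))// (ev_rec (shift n d))//.
rewrite !shift_shift addn1 /shift !addn0 exprS.
have p0 : p != 0 by rewrite gt_eqF//; lra.
by field; rewrite ?expf_neq0 ?p0.
Qed.

Lemma ev_agree_le p c d n : 1 < p -> (forall i, (i < n)%N -> c i = d i) ->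
  `|ev p c - ev p d| <= top M p / p ^+ n.
Proof.
move=> p1 h; rewrite (ev_agree p1 h) normrM normfV [`|p ^+ n|]ger0_norm; last first.
  by rewrite exprn_ge0//; lra.
rewrite ler_wpM2r ?invr_ge0 ?exprn_ge0//; first lra.
rewrite ler_norml.
have := @ev_ge0 _ _ p (shift n c) p1; have := @ev_ge0 _ _ p (shift n d) p1.
have := @ev_le_top _ _ p (shift n c) p1; have := @ev_le_top _ _ p (shift n d) p1.
by move=> *; apply/andP; split; lra.
Qed.

Lemma top_gt1 p : 1 < p -> p < M%:R + 1 -> 1 < top M p.
Proof. by move=> p1 pM; rewrite /top ltr_pdivlMr; lra. Qed.

(** The digits at [n] differ by at least [1], the tail of [d] is at most [1] and, by reflection,
    that of [c] is at least [top M p - 1]. The resulting gap is positive because [p < M%:R + 1]. *)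
Lemma weakly_univoque_sep p c d n : 1 < p -> p < M%:R + 1 ->
  weakly_univoque p c -> weakly_univoque p d ->
  (forall i, (i < n)%N -> c i = d i) -> (d n < c n)%N ->
  (top M p - 1) / p ^+ n.+1 <= ev p c - ev p d.
Proof.
move=> p1 pM hc hd h dc; rewrite (ev_diff p1 h).
rewrite ler_wpM2r ?invr_ge0 ?exprn_ge0//; first lra.
have : ev p (shift n.+1 d) <= 1.
  by apply: hd; exists n; left; split=> //; have := digit_le c n; lia.
have : ev p (shift n.+1 (refl c)) <= 1.
  by apply: hc; exists n; right; split=> //; lia.
rewrite -refl_shift ev_refl//.
have : (d n : nat)%:R + 1 <= (c n : nat)%:R :> R by rewrite natr1 ler_nat.
lra.
Qed.

Lemma weakly_univoque_sepN p c d n : 1 < p -> p < M%:R + 1 ->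
  weakly_univoque p c -> weakly_univoque p d ->
  (forall i, (i < n)%N -> c i = d i) -> c n <> d n ->
  (top M p - 1) / p ^+ n.+1 <= `|ev p c - ev p d|.
Proof.
move=> p1 pM hc hd h cd; have [dc|dc|/val_inj/esym//] := ltngtP (d n) (c n).
- by apply: le_trans (ler_norm _); apply: weakly_univoque_sep.
- rewrite distrC; apply: le_trans (ler_norm _); apply: weakly_univoque_sep => //.
  by move=> i /h.
Qed.

Lemma weakly_univoque_inj p c d : 1 < p -> p < M%:R + 1 ->
  weakly_univoque p c -> weakly_univoque p d -> ev p c = ev p d -> c = d.
Proof.
move=> p1 pM hc hd e; apply: contrapT => /first_difference[n [h cd]].
have := weakly_univoque_sepN p1 pM hc hd h cd; rewrite e subrr normr0 leNgt.
by rewrite divr_gt0 ?exprn_gt0//; have := top_gt1 p1 pM; lra.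
Qed.

(* The greedy algorithm. *)
Lemma expansion_exists p y : 1 < p -> p <= M%:R + 1 -> 0 <= y <= top M p ->
  exists d, ev p d = y.
Proof.
move=> p1 pM y01.
(* The cap matters, since [p * z] can be as large as [M%:R + top M p]. *)
pose digit (z : R) : nat := minn M (Num.truncn (p * z)).
pose step (z : R) : R := p * z - (digit z)%:R.
have stepP z : 0 <= z <= top M p -> 0 <= step z <= top M p.
  move=> /andP[z0 zt]; rewrite /step /digit.
  have pz0 : 0 <= p * z by rewrite mulr_ge0//; lra.
  have /andP[h1 h2] := truncn_itv pz0.
  have [MT|TM] := leqP M (Num.truncn (p * z)).
    have : M%:R <= (Num.truncn (p * z))%:R :> R by rewrite ler_nat.
    have : p * z <= p * top M p by rewrite ler_wpM2l//; lra.
    have : p * top M p = M%:R + top M p.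
      by rewrite /top; field; rewrite subr_eq0 gt_eqF.
    by move=> *; apply/andP; split; lra.
  (* Below the cap the remainder is less than [1], and [p <= M%:R + 1] puts it below [top M p]. *)
  have : 1 <= top M p by rewrite /top ler_pdivlMr; lra.
  by move: h2; rewrite -natr1 => *; apply/andP; split; lra.
pose z n := iter n step y.
have zP n : 0 <= z n <= top M p by elim: n => //= n; apply: stepP.
exists (fun n => inord (digit (z n))).
apply: (@ev_orbit _ _ p _ z (top M p)) => // n.
  by rewrite ger0_norm; case/andP: (zP n).
by rewrite /= /step inordK ?ltnS ?geq_minl// addrC subrK.
Qed.

(** A tail of value at least [1] allows a carry: raising digit [n] by one and expanding the tail
    value minus [1] gives a second expansion. *)
Lemma unique_tail_lt1 p d n : 1 < p -> p <= M%:R + 1 ->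
  (forall c, ev p c = ev p d -> c = d) -> (d n < M)%N -> ev p (shift n.+1 d) < 1.
Proof.
move=> p1 pM h dn; rewrite ltNge; apply/negP => t1.
have [|c' hc'] := @expansion_exists p (ev p (shift n.+1 d) - 1) p1 pM.
  by rewrite subr_ge0 t1 lerBlDr (le_trans (ev_le_top _ p1))// lerDl.
pose c i := if (i < n)%N then d i else if i == n then inord (d n).+1
  else c' (i - n.+1)%N.
have cn : c n = inord (d n).+1 by rewrite /c ltnn eqxx.
have cS : shift n.+1 c = c'.
  apply/funext => i; rewrite /shift /c addKn.
  have -> : (n.+1 + i < n)%N = false by lia.
  by have -> : (n.+1 + i == n)%N = false by lia.
have cd : ev p c = ev p d.
  apply/eqP; rewrite -subr_eq0 (@ev_diff p c d n)// => [|i ni]; last first.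
    by rewrite /c ni.
  rewrite cS cn hc' inordK ?ltnS// -natr1.
  by apply/eqP; rewrite (_ : _ + _ = 0) ?mul0r//; ring.
have : c n = d n :> nat by rewrite (h _ cd).
rewrite cn inordK ?ltnS//; lia.
Qed.

Lemma univoque_points_univoque p x : 1 < p -> p <= M%:R + 1 ->
  univoque_points M p x -> exists2 d : nat -> 'I_M.+1, ev p d = x & univoque p d.
Proof.
move=> p1 pM [_ [d [dx duniq]]]; have dE := expansion_ev dx.
have u1 c : ev p c = ev p d -> c = d.
  rewrite dE => cx; apply/esym/duniq; rewrite -cx; exact: ev_expansion.
exists d => // t [n [[dn ->]|[dn ->]]]; apply: unique_tail_lt1 => //.
  move=> c; rewrite ev_refl// => e; rewrite -(u1 (refl c)) ?reflK// ev_refl// e; ring.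
by rewrite refl_ltM.
Qed.

(** The tail of [d] is worth less than the unit gained at digit [n], and the arbitrary tail of [c]
    is worth at least [0]. *)
Lemma univoque_lt p c d n : 1 < p -> univoque p d ->
  (forall i, (i < n)%N -> c i = d i) -> (d n < c n)%N -> ev p d < ev p c.
Proof.
move=> p1 hd h dc; rewrite -subr_gt0 (ev_diff p1 h) divr_gt0 ?exprn_gt0//; last lra.
have : ev p (shift n.+1 d) < 1.
  by apply: hd; exists n; left; split=> //; have := digit_le c n; lia.
have : (d n : nat)%:R + 1 <= (c n : nat)%:R :> R by rewrite natr1 ler_nat.
have := @ev_ge0 _ _ p (shift n.+1 c) p1; lra.
Qed.

Lemma univoque_unique p c d : 1 < p -> univoque p d -> ev p c = ev p d -> c = d.
Proof.
move=> p1 hd e; apply: contrapT => /first_difference[n [h cd]].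
have [dc|dc|/val_inj/esym//] := ltngtP (d n) (c n).
  by have := univoque_lt p1 hd h dc; rewrite e ltxx; auto.
suff: ev p (refl d) < ev p (refl c) by rewrite !ev_refl// e ltxx.
apply: (@univoque_lt p (refl c) (refl d) n p1 (univoque_refl hd)).
  by move=> i /h; rewrite /refl => ->.
by rewrite !val_refl; have := digit_le d n; lia.
Qed.

Lemma univoque_univoque_points p d : 1 < p -> univoque p d ->
  univoque_points M p (ev p d).
Proof.
move=> p1 hd; split; first by rewrite ev_ge0// ev_le_top.
exists d; split; first exact: ev_expansion.
by move=> c /expansion_ev e; rewrite (univoque_unique p1 hd e).
Qed.

Lemma univoque_bases1 p d : 1 < p -> p <= M%:R + 1 -> univoque p d -> ev p d = 1 ->
  univoque_bases M 1 p.
Proof.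
by move=> p1 pM hd d1; split; [rewrite p1|rewrite -d1; exact: univoque_univoque_points].
Qed.

End UnivoqueSequences.

(** * The quasi-greedy limit *)

Section QuasiGreedy.
Context {R : realType} {M : nat}.
Implicit Types (p s : R) (d c e t : nat -> 'I_M.+1).

(** One [delta] serves all digit sequences, so a change of base controls all tails of a sequence at
    once. *)
Lemma ev_uniform (a eps : R) : 1 < a -> 0 < eps -> exists2 delta : R, 0 < delta &
  forall p p' d, a <= p -> a <= p' -> `|p - p'| < delta -> `|ev p d - ev p' d| < eps.
Proof.
move=> a1 e0; set L := M%:R / (a - 1) ^+ 2 : R.
have L0 : 0 <= L by rewrite divr_ge0 ?ler0n// exprn_ge0//; lra.
exists (eps / (L + 1)); first by rewrite divr_gt0//; lra.
move=> p p' d ap ap'; rewrite ltr_pdivlMr; last lra.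
move=> h; apply: le_lt_trans (ev_lipschitz d a1 ap ap') _.
by rewrite -/L; have := normr_ge0 (p - p'); nra.
Qed.

(** Contrapositive of separation: a difference before place [n] would keep the values at least this
    far apart. *)
Lemma weakly_univoque_agree s c d n : 1 < s -> s < M%:R + 1 ->
  weakly_univoque s c -> weakly_univoque s d ->
  `|ev s c - ev s d| < (top M s - 1) / s ^+ n -> forall i, (i < n)%N -> c i = d i.
Proof.
move=> s1 sM hc hd h i ni; apply: contrapT => cdi.
have /first_difference[N [agr cdN]] : c <> d by move=> cd; rewrite cd in cdi.
have Ni : (N <= i)%N by rewrite leqNgt; apply/negP => /agr.
have := weakly_univoque_sepN s1 sM hc hd agr cdN; rewrite leNgt => /negP; apply.
apply: lt_le_trans h _; rewrite ler_pM2l; last by have := top_gt1 s1 sM; lra.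
rewrite lef_pV2 ?posrE ?exprn_gt0; try lra.
by rewrite ler_eXn2l//; lia.
Qed.

(** If a tail of [e] exceeded [1], so would the corresponding tail of any approximant with a long
    enough common prefix. *)
Lemma weakly_univoque_closed s e : 1 < s ->
  (forall n, exists2 t, weakly_univoque s t & forall i, (i < n)%N -> t i = e i) ->
  weakly_univoque s e.
Proof.
move=> s1 h u [k hu]; rewrite leNgt; apply/negP => u1.
have [j hj] := @geometric_lt _ s (top M s) (ev s u - 1) s1 ltac:(lra).
have [t ht te] := h (k.+1 + j)%N.
have tk : t k = e k by apply: te; lia.
pose v := if ((e k < M)%N && `[< u = shift k.+1 e >]) then shift k.+1 t
  else shift k.+1 (refl t).
have [v1 uv] : ev s v <= 1 /\ forall i, (i < j)%N -> u i = v i.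
  rewrite /v; case: ifPn => [/andP[ek /asboolP ->]|nu].
    split; first by apply: ht; exists k; left; rewrite tk.
    by move=> i ij; rewrite /shift te//; lia.
  case: hu => [[ek eu]|[ek ->]].
    by move: nu; rewrite ek/= => /asboolP.
  split; first by apply: ht; exists k; right; rewrite tk.
  by move=> i ij; rewrite /shift /refl te//; lia.
have := ev_agree_le s1 uv; rewrite ler_norml => /andP[_]; lra.
Qed.

(* [s] is the infimum of the bases in which [d] is weakly univoque. *)
Lemma critical_base (P Q : R) d : 1 < P -> P <= Q -> univoque Q d -> ~ univoque P d ->
  exists s, [/\ P <= s <= Q, weakly_univoque s d &
    forall eta : R, 0 < eta -> exists2 t, admissible_tail d t & 1 - eta < ev s t].
Proof.
move=> P1 PQ dQ dP.
pose E : set R := [set r | P <= r <= Q /\ weakly_univoque r d].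
have EQ : E Q by split; [rewrite PQ lexx|exact: univoqueW].
have Elb : has_inf E by split; [exists Q|exists P => r [/andP[]]].
have Ps : P <= inf E by apply: lb_le_inf; [exists Q|move=> r [/andP[]]].
have sQ : inf E <= Q by apply: ge_inf => //; case: Elb.
exists (inf E); split; first by rewrite Ps.
- move=> t dt; rewrite leNgt; apply/negP => t1.
  have [delta d0 h] := ev_uniform P1 (eps := ev (inf E) t - 1) ltac:(lra).
  have [r Er rs] := inf_adherent d0 Elb.
  have sr : inf E <= r by apply: ge_inf => //; case: Elb.
  have := Er.2 _ dt; have := h r (inf E) t.
  rewrite ger0_norm ?subr_ge0// ltr_norml => /(_ _ _ _)/andP[]; lra.
- move=> eta eta0; apply: contrapT => hn.
  have small t : admissible_tail d t -> ev (inf E) t <= 1 - eta.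
    by move=> dt; rewrite leNgt; apply/negP => ht; apply: hn; exists t.
  have [delta d0 h] := ev_uniform P1 eta0.
  (* Were all tails at most [1 - eta], [d] would still be univoque in this lower base. If [r] is
     [P], this contradicts [dP]; otherwise it undercuts the infimum. *)
  pose r := Num.max P (inf E - delta / 2).
  have Pr : P <= r by rewrite le_max lexx.
  have rs : r <= inf E by rewrite ge_max Ps; lra.
  have rd : inf E - delta / 2 <= r by rewrite le_max lexx orbT.
  have ur : univoque r d.
    move=> t dt; have := small _ dt; have := h r (inf E) t Pr Ps.
    by rewrite ler0_norm ?subr_le0// ltr_norml => /(_ _)/andP[]; lra.
  have : inf E <= r.
    apply: ge_inf; first by case: Elb.
    by split; [rewrite Pr (le_trans rs)|exact: univoqueW].
  move=> sr; move: rd sr; rewrite /r; case: (leP P (inf E - delta / 2)) => [|lt]; first lra.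
  by move=> *; apply: dP; move: ur; rewrite /r; case: leP => //; lra.
Qed.

(* Consecutive approximants agree on longer and longer prefixes by the separation
   lemma, so that no compactness argument is needed. *)
Lemma quasi_greedy_limit s d : 1 < s -> s < M%:R + 1 -> weakly_univoque s d ->
  (forall eta : R, 0 < eta -> exists2 t, admissible_tail d t & 1 - eta < ev s t) ->
  exists e, [/\ weakly_univoque s e, ev s e = 1 &
    forall n, exists2 t, admissible_tail d t & forall i, (i < n)%N -> t i = e i].
Proof.
move=> s1 sM hd sup1; have t1 := top_gt1 s1 sM.
have kpos n : 0 < (top M s - 1) / s ^+ n by rewrite divr_gt0 ?exprn_gt0//; lra.
have /choice[t ht] : forall n, exists t, admissible_tail d t /\
    1 - (top M s - 1) / s ^+ n.+1 < ev s t.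
  by move=> n; have [t] := sup1 _ (kpos n.+1); exists t.
have tw n : weakly_univoque s (t n) by apply: weakly_univoque_tail hd _; exact: (ht n).1.
have tle n : ev s (t n) <= 1 by apply: hd; exact: (ht n).1.
have kanti m n : (m <= n)%N ->
    (top M s - 1) / s ^+ n.+1 <= (top M s - 1) / s ^+ m.+1.
  move=> mn; rewrite ler_wpM2l; [|lra|]; last first.
    by rewrite lef_pV2 ?posrE ?exprn_gt0 ?ler_eXn2l//; lra.
  done.
have agr m n i : (m <= n)%N -> (i < m.+1)%N -> t m i = t n i.
  move=> mn; apply: (weakly_univoque_agree s1 sM) => //.
  rewrite ltr_norml; have := (ht m).2; have := (ht n).2; have := tle m; have := tle n.
  by have := kanti _ _ mn; move=> *; apply/andP; split; lra.
(* The diagonal sequence shares its first [n.+1] digits with each [t n]. *)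
exists (fun i => t i i).
have te n i : (i < n.+1)%N -> t n i = t i i by move=> ni; apply/esym/agr.
split.
- apply: weakly_univoque_closed => // n; exists (t n) => // i ni; apply: te; lia.
- apply/eqP; rewrite -subr_eq0; apply/eqP.
  apply: (@geometric_squeeze _ s (2 * top M s)) => // n.
  have : `|ev s (fun i => t i i) - ev s (t n)| <= top M s / s ^+ n.
    by apply: ev_agree_le => // i ni; apply/esym/te; lia.
  have : (top M s - 1) / s ^+ n.+1 <= top M s / s ^+ n.
    apply: ler_pM => //; [lra|rewrite invr_ge0 exprn_ge0//; lra|lra|].
    by rewrite lef_pV2 ?posrE ?exprn_gt0 ?ler_eXn2l//; lra.
  rewrite -mulrA !ler_norml; have := (ht n).2; have := tle n.
  by move=> ? ? ? /andP[? ?]; apply/andP; split; lra.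
- by move=> n; exists (t n); [exact: (ht n).1|move=> i ni; apply: te; lia].
Qed.

(** An admissible tail of value [1] is [e] itself, by injectivity. Without one, [e] would be
    univoque and [s] a univoque base of [1]. *)
Lemma quasi_greedy_self_tail s e : 1 < s -> s < M%:R + 1 -> weakly_univoque s e ->
  ev s e = 1 -> ~ univoque_bases M 1 s -> admissible_tail e e.
Proof.
move=> s1 sM he e1 hU; apply: contrapT => ne; apply: hU.
apply: (@univoque_bases1 _ _ s e) => //; first exact: ltW.
move=> t et; rewrite lt_neqAle he// andbT; apply/eqP => t1; apply: ne.
rewrite {2}(_ : e = t)//; apply: (weakly_univoque_inj s1 sM) => //; last by rewrite t1.
exact: weakly_univoque_tail et.
Qed.

(** The reflected alternative of [admissible_tail e e]. Such an [e] turns out to be isolated; the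
    other alternative needs the perturbation argument. *)
Definition self_reflecting e :=
  exists k, (0 < e k)%N /\ e = shift k.+1 (refl e).

(* [t = w t'] and [e = w (refl e)]; the reflected tail of [t] after [w] is at most
   that of [e], which forces [ev s e <= ev s t]. *)
Lemma self_reflecting_isolated s e : 1 < s -> s < M%:R + 1 -> weakly_univoque s e ->
  ev s e = 1 -> self_reflecting e -> exists n, forall t, weakly_univoque s t ->
  ev s t <= 1 -> (forall i, (i < n)%N -> t i = e i) -> t = e.
Proof.
move=> s1 sM he e1 [k [ek eE]]; exists k.+1 => t ht t1 te.
apply: (weakly_univoque_inj s1 sM) => //; apply/eqP; rewrite eq_le e1 t1 /= -e1.
rewrite -subr_ge0 (ev_agree s1 te) divr_ge0 ?exprn_ge0//; last lra.
have : ev s (shift k.+1 (refl t)) <= 1.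
  by apply: ht; exists k; right; rewrite te.
have : ev s (shift k.+1 (refl e)) = 1 by rewrite -eE.
by rewrite -!refl_shift !ev_refl//; lra.
Qed.

End QuasiGreedy.

(** * Periodic approximation *)

Section PeriodicApproximation.
Context {R : realType} {M : nat}.
Implicit Types (p s : R) (d c e t : nat -> 'I_M.+1).

Lemma finite_gap (N : nat) (P : pred nat) (f : nat -> R) :
  (forall n, (n < N)%N -> P n -> f n < 1) ->
  exists2 eta : R, 0 < eta & forall n, (n < N)%N -> P n -> f n <= 1 - eta.
Proof.
elim: N => [|N IH] h; first by exists 1.
have [n nN|eta eta0 he] := IH; first by apply: h; exact: ltnW.
have [PN|nPN] := boolP (P N); last first.
  exists eta => // n; rewrite ltnS leq_eqVlt => /orP[/eqP-> PN|]; last exact: he.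
  by rewrite PN in nPN.
have fN := h N (ltnSn N) PN.
exists (Num.min eta (1 - f N)); first by rewrite lt_min eta0 subr_gt0.
move=> n; rewrite ltnS leq_eqVlt => /orP[/eqP-> _|nN Pn].
  by rewrite lerBrDl -lerBrDr ge_min lexx orbT.
by apply: le_trans (he _ nN Pn) _; rewrite lerB// ge_min lexx.
Qed.

Lemma periodic_eq c d m : (0 < m)%N -> shift m c = c -> shift m d = d ->
  (forall i, (i < m)%N -> c i = d i) -> c = d.
Proof.
move=> m0 hc hd h; apply/funext => i; have [n] := ubnP i.
elim: n i => // n IH i; rewrite ltnS => ni.
have [im|mi] := ltnP i m; first exact: h.
rewrite -(subnKC mi) -[LHS]/(shift m c (i - m)%N) -[RHS]/(shift m d (i - m)%N).
by rewrite hc hd; apply: IH; lia.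
Qed.

(** If [refl e] started at place [h] of [e], then one period later [refl e] would return to [e]
    right after the digit [refl e k], which is positive, making [e] self-reflecting. *)
Lemma shift_neq_refl e k h : (e k < M)%N -> shift k.+1 e = e ->
  ~ self_reflecting e -> shift h e <> refl e.
Proof.
move=> ek eper nsr eh; apply: nsr; exists (h + k)%N; split.
  have -> : e (h + k)%N = refl e k by rewrite -eh.
  by rewrite refl_gt0.
have hr : shift h (refl e) = e by rewrite -refl_shift eh reflK.
by rewrite -addnS -shift_shift hr eper.
Qed.

(* The periodic point [c] on the word between two tails of [d] close to [e] with
   increasing values lies below both of them, and so do its tails. Its reflected
   tails stay below [1] because no tail of [e] equals [refl e]. *)
Lemma periodic_approximation s e k d (eps : R) : 1 < s -> s < M%:R + 1 ->
  weakly_univoque s e -> ev s e = 1 -> (e k < M)%N -> shift k.+1 e = e ->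
  ~ self_reflecting e -> weakly_univoque s d ->
  ~ admissible_tail d e -> 0 < eps ->
  (forall eta : R, 0 < eta -> exists2 n, (d n < M)%N & 1 - eta < ev s (shift n.+1 d)) ->
  exists c, [/\ univoque s c, admissible_tail c c, 1 - eps < ev s c &
    exists2 eta : R, 0 < eta & forall t, admissible_tail c t -> ev s t <= 1 - eta].
Proof.
move=> s1 sM he e1 ek eper nsr hd nde eps0 sup1; have t1 := top_gt1 s1 sM.
have ud : univoque s d.
  move=> t dt; rewrite lt_neqAle hd// andbT; apply/eqP => te; apply: nde.
  rewrite (_ : e = t)//; apply: (weakly_univoque_inj s1 sM) => //.
    exact: weakly_univoque_tail dt.
  by rewrite te.
(* Values closer than [kap] force agreement on [k.+1] digits, a full period of [e]. *)
pose kap : R := (top M s - 1) / s ^+ k.+1.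
have kap0 : 0 < kap by rewrite divr_gt0 ?exprn_gt0//; lra.
have si : s^-1 < 1 by rewrite invf_lt1; lra.
(* The quantity [D] introduced below satisfies [(1 - s^-1) * D < eta1], so this choice keeps [2 * D]
   below both [eps] and [kap]. *)
pose eta1 : R := Num.min eps kap * (1 - s^-1) / 2.
have m0 : 0 < Num.min eps kap by rewrite lt_min eps0.
have eta10 : 0 < eta1 by rewrite divr_gt0// mulr_gt0//; lra.
have eta1E : 2 * eta1 = Num.min eps kap * (1 - s^-1).
  by rewrite /eta1; field; rewrite gt_eqF//; lra.
have meps : Num.min eps kap <= eps by rewrite ge_min lexx.
have mkap : Num.min eps kap <= kap by rewrite ge_min lexx orbT.
have s0 : 0 < s^-1 by rewrite invr_gt0; lra.
have eta1m : 2 * eta1 < Num.min eps kap by rewrite eta1E; nra.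
have [i di ti1] := sup1 _ eta10.
(* The finitely many tails up to place [i] stay below [1] by a common gap, so some later tail
   exceeds them all. *)
have [j ij [dj tij]] : exists2 j, (i < j)%N & (d j < M)%N /\
    ev s (shift i.+1 d) < ev s (shift j.+1 d).
  have [n _ dn|eta eta0 heta] := @finite_gap i.+1 (fun n => (d n < M)%N)
    (fun n => ev s (shift n.+1 d)).
    by apply: ud; exists n; left.
  have [j dj tj] := sup1 _ eta0; have ij : (i < j)%N.
    rewrite ltnNge; apply/negP => ji; have := heta j; rewrite ltnS => /(_ ji dj).
    by rewrite leNgt tj.
  by exists j => //; split=> //; apply: le_lt_trans tj; exact: heta (ltnSn i) di.
have dti : admissible_tail d (shift i.+1 d) by exists i; left.
have dtj : admissible_tail d (shift j.+1 d) by exists j; left.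
have tj1 := ud _ dtj; have ti_lt1 := ud _ dti.
set ti := shift i.+1 d in ti1 tij dti ti_lt1; set tj := shift j.+1 d in tij dtj tj1.
pose l := (j - i)%N; have l0 : (0 < l)%N by rewrite subn_gt0.
have il : (i + l = j)%N by rewrite /l subnKC// ltnW.
have ilj : (i.+1 + l = j.+1)%N by rewrite addSn il.
have til : shift l ti = tj by rewrite /ti shift_shift ilj.
have tij' : ti l.-1 = d j by rewrite /ti /shift addSnnS prednK// il.
clearbody ti tj.
pose c : nat -> 'I_M.+1 := fun r => ti (r %% l)%N.
have cl : shift l c = c by apply/funext => r; rewrite /shift /c modnDl.
have cti r : (r < l)%N -> ti r = c r by move=> rl; rewrite /c modn_small.
(* After a common word of length [l], [ti] continues with [tj] and [c] with [c]. Hence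
   [ev s tj - ev s ti] is [(1 - (s ^+ l)^-1) * D], and [D] is positive. *)
pose D := ev s tj - ev s c.
have tcD : ev s ti - ev s c = D / s ^+ l by rewrite (ev_agree s1 cti) til cl.
have lam : 0 < (s ^+ l)^-1 <= s^-1.
  rewrite invr_gt0 exprn_gt0/=; last lra.
  by rewrite lef_pV2 ?posrE ?exprn_gt0 ?ler_eXnr//; lra.
have [D0 Dm] : 0 < D /\ 2 * D < Num.min eps kap.
  have : ev s tj - ev s ti = (1 - (s ^+ l)^-1) * D.
    by rewrite mulrBl mul1r [_^-1 * D]mulrC -tcD /D; ring.
  move: lam; set la := (s ^+ l)^-1 => /andP[la0 la1] tjiE.
  have D0 : 0 < D.
    rewrite -(pmulr_rgt0 _ (_ : 0 < 1 - la)); last lra.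
    by rewrite -tjiE subr_gt0.
  split=> //; rewrite -(ltr_pM2r (_ : 0 < 1 - s^-1)); last lra.
  rewrite -eta1E; have : D * (1 - s^-1) <= D * (1 - la) by rewrite ler_wpM2l//; lra.
  by lra.
have cshift r : shift r.+1 c = shift (r %% l).+1 c.
  by apply/funext => x; rewrite /shift /c !addSn -!addnS modnDml.
have ctail r : (r < l)%N ->
    ev s (shift r.+1 c) = ev s (shift r.+1 ti) - D / s ^+ (l - r.+1).
  move=> rl; have := @ev_agree _ _ s (shift r.+1 ti) (shift r.+1 c) (l - r.+1) s1.
  rewrite !shift_shift subnKC// til cl -/D => <-; first by ring.
  by move=> x xl; rewrite /shift cti// -ltn_subRL.
have unrefl r : (r < l)%N -> (c r < M)%N -> ev s (shift r.+1 c) < 1.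
  move=> rl cr; rewrite ctail//.
  have : ev s (shift r.+1 ti) < 1.
    by apply: ud; apply: admissible_tail_trans dti _; exists r; left; rewrite cti.
  by have := @divr_gt0 _ _ _ D0 (exprn_gt0 (l - r.+1) (_ : 0 < s)); lra.
have refl' r : (r < l)%N -> (0 < c r)%N -> ev s (shift r.+1 (refl c)) < 1.
  move=> rl cr; set h := (l - r.+1)%N.
  have -> : ev s (shift r.+1 (refl c)) = ev s (shift r.+1 (refl ti)) + D / s ^+ h.
    by rewrite -!refl_shift !ev_refl// ctail// -/h; ring.
  set g := shift r.+1 (refl ti).
  have dg : admissible_tail d g.
    by apply: admissible_tail_trans dti _; exists r; right; rewrite cti.
  (* Otherwise [g] is so close to value [1] that it agrees with [e] on [h + k.+1] digits. The last
     [k.+1] of these come from [refl tj], and [tj] starts with a period of [e], so [shift h e] would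
     be [refl e]. *)
  rewrite ltNge; apply/negP => g1; have g_lt1 := ud _ dg.
  have gagr : forall x, (x < h + k.+1)%N -> g x = e x.
    apply: (weakly_univoque_agree s1 sM) => //; first exact: weakly_univoque_tail dg.
    rewrite exprD invfM mulrCA -/kap e1 ler0_norm; last lra.
    have : D / s ^+ h < kap / s ^+ h.
      by rewrite ltr_pM2r ?invr_gt0 ?exprn_gt0//; lra.
    by rewrite mulrC; lra.
  apply: (@shift_neq_refl _ _ h ek eper nsr); apply: (@periodic_eq _ _ k.+1) => //.
  - by rewrite shift_shift addnC -shift_shift eper.
  - by rewrite -refl_shift eper.
  - move=> x xk; rewrite -[LHS]/(e (h + x)%N) -gagr; last by rewrite ltn_add2l.
    have -> : g (h + x)%N = refl tj x.
      by rewrite -til /g /shift /refl addnA subnKC.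
    congr rev_ord; apply: (weakly_univoque_agree s1 sM) xk => //.
      exact: weakly_univoque_tail dtj.
    by rewrite e1 ler0_norm -/kap; lra.
have [eta2 eta20 h2] := finite_gap unrefl; have [eta3 eta30 h3] := finite_gap refl'.
have gap : exists2 eta : R, 0 < eta & forall t, admissible_tail c t -> ev s t <= 1 - eta.
  exists (Num.min eta2 eta3); first by rewrite lt_min eta20.
  move=> t [r [[cr ->]|[cr ->]]].
    have rl : (r %% l < l)%N by rewrite ltn_pmod.
    rewrite cshift; apply: le_trans (h2 _ rl _) _; first by rewrite /c modn_mod.
    by rewrite lerB// ge_min lexx.
  have rl : (r %% l < l)%N by rewrite ltn_pmod.
  rewrite -refl_shift cshift refl_shift; apply: le_trans (h3 _ rl _) _.
    by rewrite /c modn_mod.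
  by rewrite lerB// ge_min lexx orbT.
exists c; split=> //.
- move=> t ct; have [eta eta0 h] := gap; have := h _ ct; lra.
- exists l.-1; left; rewrite prednK// cl; split=> //.
  by rewrite -cti ?prednK// tij'.
- by rewrite /D in D0 Dm; lra.
Qed.

End PeriodicApproximation.

(** * Bases off the closure *)

Section Gap.
Context {R : realType} {M : nat}.
Implicit Types (p s : R) (d c e t : nat -> 'I_M.+1).

Lemma ev_IVT (a b y : R) d : 1 < a -> a <= b -> ev b d <= y -> y <= ev a d ->
  exists2 p, a <= p <= b & ev p d = y.
Proof.
move=> a1 ab yb ya.
have cont : {within `[a, b], continuous (fun p => ev p d)}.
  apply/subspace_continuousP => p /=; rewrite in_itv /= => /andP[ap _].
  apply/cvgrPdist_lt => eps eps0; have [delta d0 h] := ev_uniform (M := M) a1 eps0.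
  apply/nbhs_ballP; exists delta => //= r pr; rewrite /= in_itv /= => /andP[ar _].
  exact: h.
have [|p] := @IVT R (fun p => ev p d) a b y ab cont.
  by rewrite ge_min le_max ya yb orbT.
by rewrite in_itv; exists p.
Qed.

(* [f = w c'] with [e = w e] and [c'] quasi-greedy in a base slightly below [s]. *)
Lemma univoque_base_below s e k d (theta : R) : 1 < s -> s < M%:R + 1 ->
  weakly_univoque s e -> ev s e = 1 -> (e k < M)%N -> shift k.+1 e = e ->
  ~ self_reflecting e -> weakly_univoque s d -> ~ admissible_tail d e ->
  (forall eta : R, 0 < eta -> exists2 n, (d n < M)%N & 1 - eta < ev s (shift n.+1 d)) ->
  0 < theta -> exists2 p, s - theta < p < s & univoque_bases M 1 p.
Proof.
move=> s1 sM he e1 ek0 eper0 nsr hd nde sup1 theta0.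
(* With the first return [m], the admissible unreflected tails of [e] starting earlier are strictly
   below [1]. *)
have [m /andP[em /asboolP eper] mmin] : exists2 m, (e m < M)%N && `[< shift m.+1 e = e >] &
    forall n, (e n < M)%N && `[< shift n.+1 e = e >] -> (m <= n)%N.
  have /ex_minnP[m ? ?] : exists m, (e m < M)%N && `[< shift m.+1 e = e >].
    by exists k; rewrite ek0; apply/asboolP.
  by exists m.
have [n nm en|eta1 eta10 h1] := @finite_gap _ m (fun n => (e n < M)%N)
    (fun n => ev s (shift n.+1 e)).
  have et : admissible_tail e (shift n.+1 e) by exists n; left.
  rewrite lt_neqAle he// andbT; apply/eqP => t1.
  have : (m <= n)%N; last by rewrite leqNgt nm.
  apply: mmin; rewrite en; apply/asboolP; apply: (weakly_univoque_inj s1 sM) => //.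
    exact: weakly_univoque_tail et.
  by rewrite t1.
have [n nm en|eta2 eta20 h2] := @finite_gap _ m.+1 (fun n => (0 < e n)%N)
    (fun n => ev s (shift n.+1 (refl e))).
  have et : admissible_tail e (shift n.+1 (refl e)) by exists n; right.
  rewrite lt_neqAle he// andbT; apply/eqP => t1; apply: nsr; exists n; split=> //.
  apply: (weakly_univoque_inj s1 sM) => //; last by rewrite t1.
  exact: weakly_univoque_tail et.
pose eta := Num.min eta1 eta2 / 2.
have [eta0 eta1E eta2E] : [/\ 0 < eta, 2 * eta <= eta1 & 2 * eta <= eta2].
  have : 2 * eta = Num.min eta1 eta2 by rewrite /eta; field.
  have : Num.min eta1 eta2 <= eta1 by rewrite ge_min lexx.
  have : Num.min eta1 eta2 <= eta2 by rewrite ge_min lexx orbT.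
  have : 0 < Num.min eta1 eta2 by rewrite lt_min eta10.
  by move=> *; split; lra.
pose a := (1 + s) / 2.
have a1 : 1 < a by rewrite /a; lra.
have [delta delta0 close] := ev_uniform (M := M) a1 eta0.
have [P [aP Ps Ptheta Pdelta]] : exists P, [/\ a <= P, P < s, s - theta < P & s - P < delta].
  pose z := Num.min (Num.min delta theta) (s - a) / 2.
  have z2 : 2 * z = Num.min (Num.min delta theta) (s - a) by rewrite /z; field.
  have : 0 < Num.min (Num.min delta theta) (s - a).
    by rewrite !lt_min delta0 theta0 /a; lra.
  have : Num.min (Num.min delta theta) (s - a) <= s - a by rewrite ge_min lexx orbT.
  have : Num.min (Num.min delta theta) (s - a) <= delta by rewrite !ge_min lexx.
  have : Num.min (Num.min delta theta) (s - a) <= theta by rewrite !ge_min lexx orbT.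
  by move=> *; exists (s - z); split; lra.
clearbody a eta.
have P1 : 1 < P by lra.
(* With this margin the approximation gives [P < s * ev s c <= P * ev P c], so [c], a tail of
   itself, is not univoque in base [P]. *)
have Ps1 : 0 < 1 - P / s by rewrite subr_gt0 ltr_pdivrMr; lra.
have [c [uc cc cP [eta3 eta30 cgap]]] :=
  periodic_approximation s1 sM he e1 ek0 eper0 nsr hd nde Ps1 sup1.
have nuc : ~ univoque P c.
  move=> /(_ _ cc); apply/negP; rewrite -leNgt.
  have := ler_ev c P1 (ltW Ps).
  have : P < s * ev s c by rewrite mulrC -ltr_pdivrMr; lra.
  by move=> ? ?; rewrite -(ler_pM2l (_ : 0 < P)); lra.
have [r [/andP[Pr rs] wc rsup]] := critical_base P1 (ltW Ps) uc nuc.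
(* In base [s] the tails of [c] stay away from [1], so [s] cannot be the critical base. *)
have {}rs : r < s.
  rewrite lt_neqAle rs andbT; apply/eqP => rE; move: rsup; rewrite rE => /(_ _ eta30).
  by case=> t /cgap; lra.
have r1 : 1 < r by exact: lt_le_trans Pr.
have rM : r < M%:R + 1 by exact: lt_trans sM.
have [c' [wc' c'1 _]] := quasi_greedy_limit r1 rM wc rsup.
clear c uc cc cP eta3 eta30 cgap nuc wc rsup Ps1 d hd nde sup1 k ek0 eper0 eta10 eta20.
have below p t : r < p -> ev r t <= 1 -> ev p t < 1.
  move=> rp t1; have := ler_ev t r1 (ltW rp) => h.
  by rewrite -(ltr_pM2l (_ : 0 < p)); [apply: le_lt_trans h _|]; nra.
have sc' : ev s c' < 1 by apply: below; rewrite // c'1.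
pose f : nat -> 'I_M.+1 := fun i => if (i < m.+1)%N then e i else c' (i - m.+1)%N.
have fe i : (i < m.+1)%N -> f i = e i by rewrite /f => ->.
have fS : shift m.+1 f = c'.
  by apply/funext => i; rewrite /shift /f addKn ltnNge leq_addr.
clearbody f.
(* Replacing the tail [e] by [c'], of value [1] in base [r], leaves [f] between [1] and [ev r e]. In
   base [s] the same replacement lowers the value below [1], so an intermediate base gives [f] the
   value [1]. *)
have fr : 1 < ev r f.
  have := ev_agree r1 fe; rewrite fS eper c'1 => h.
  have er : 1 < ev r e.
    by have := ler_ev e r1 (ltW rs); rewrite e1 => ?;
       rewrite -(ltr_pM2l (_ : 0 < r)); lra.
  have : (r ^+ m.+1)^-1 < 1.
    by rewrite invf_lt1 ?exprn_gt0 ?exprn_egt1// (lt_trans ltr01).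
  by nra.
have fs : ev s f < 1.
  have := ev_agree s1 fe; rewrite fS eper e1 => h.
  have : (ev s c' - 1) / s ^+ m.+1 < 0.
    by rewrite pmulr_llt0 ?invr_gt0 ?exprn_gt0 ?(lt_trans ltr01)// subr_lt0.
  by lra.
have [p /andP[rp ps] fp] := ev_IVT r1 (ltW rs) (ltW fs) (ltW fr).
have {}rp : r < p by rewrite lt_neqAle rp andbT; apply/eqP => rE; rewrite rE fp ltxx in fr.
have {}ps : p < s by rewrite lt_neqAle ps andbT; apply/eqP => pE; rewrite -pE fp ltxx in fs.
have p1 : 1 < p by exact: lt_trans rp.
have as' : a <= s by rewrite (le_trans aP) ?ltW.
have ar : a <= r by exact: le_trans Pr.
have pclose t : ev p t < ev s t + eta.
  have psE : `|p - s| < delta by rewrite distrC gtr0_norm ?subr_gt0//; lra.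
  have ap : a <= p by rewrite (le_trans ar) ?ltW.
  by have := close p s t ap as' psE; rewrite ltr_norml => /andP[]; lra.
have c'close : 1 - ev s c' < eta.
  have rsE : `|r - s| < delta by rewrite distrC gtr0_norm ?subr_gt0//; lra.
  by have := close r s c' ar as' rsE; rewrite c'1 ltr_norml => /andP[]; lra.
exists p; first by apply/andP; split; lra.
apply: (@univoque_bases1 _ _ p f) => //; first lra.
have tailE j : (j < m.+1)%N ->
    ev s (shift j.+1 f) = ev s (shift j.+1 e) - (1 - ev s c') / s ^+ (m - j).
  move=> jm; have agr x : (x < m - j)%N -> shift j.+1 f x = shift j.+1 e x.
    by move=> xm; rewrite /shift fe// addSn ltnS -ltn_subRL.
  have := ev_agree s1 agr; rewrite !shift_shift addSn subnKC// fS eper e1.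
  by move=> /eqP; rewrite subr_eq => /eqP ->; ring.
have tail_pos j : 0 <= (1 - ev s c') / s ^+ (m - j) <= 1 - ev s c'.
  have sj : 1 <= s ^+ (m - j) by rewrite exprn_ege1// ltW.
  have sj0 := lt_le_trans ltr01 sj; have sc0 : 0 <= 1 - ev s c' by rewrite subr_ge0 ltW.
  by rewrite (divr_ge0 sc0 (ltW sj0)) ler_pdivrMr// ler_peMr.
clear close Ptheta Pdelta aP theta0 theta fr fs delta delta0.
move=> t [j [[fj ->]|[fj ->]]].
(* Tails starting beyond [m] are tails of [c'], and those starting before are close to tails of [e].
   At [j = m] the tail of [e] has value [1] and [h1] is silent, but the tail of [f] is [c']. *)
- have [mj|jm|mj] := ltngtP m j.
  + apply: below => //; apply: wc'; exists (j - m.+1)%N; left; split.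
      by move: fj; rewrite -[in f j](subnKC mj) -[f _]/(shift _ f _) fS.
    by rewrite -fS shift_shift addnS subnKC.
  + have := pclose (shift j.+1 f); rewrite tailE; last exact: ltnW.
    have ej : (e j < M)%N by rewrite -fe// ltnS ltnW.
    by have := h1 _ jm ej; have := tail_pos j; lra.
  + by rewrite -mj fS; apply: below; rewrite // c'1.
- have [mj|jm] := ltnP m j.
    apply: below => //; apply: wc'; exists (j - m.+1)%N; right; split.
      by move: fj; rewrite -[in f j](subnKC mj) -[f _]/(shift _ f _) fS.
    by rewrite -fS refl_shift shift_shift addnS subnKC.
  have := pclose (shift j.+1 (refl f)).
  have : ev s (shift j.+1 (refl f)) = ev s (shift j.+1 (refl e)) + (1 - ev s c') / s ^+ (m - j).
    by rewrite -!refl_shift !ev_refl// tailE//; ring.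
  by have := h2 j jm; rewrite -fe// => /(_ fj); have := tail_pos j; lra.
Qed.

(** A supremum over two families is approached along one of them; after reflecting [d] if necessary,
    only unreflected tails need be followed. *)
Lemma weakly_univoque_approx_side s d :
  (forall eta : R, 0 < eta -> exists2 t, admissible_tail d t & 1 - eta < ev s t) ->
  exists2 c, c = d \/ c = refl d &
    forall eta : R, 0 < eta -> exists2 n, (c n < M)%N & 1 - eta < ev s (shift n.+1 c).
Proof.
move=> sup1; apply: contrapT => hn.
have side c : c = d \/ c = refl d -> exists2 eta : R, 0 < eta &
    forall n, (c n < M)%N -> ev s (shift n.+1 c) <= 1 - eta.
  move=> hc; apply: contrapT => h; apply: hn; exists c => // eta eta0.
  apply: contrapT => h'; apply: h; exists eta => // n cn.
  by rewrite leNgt; apply/negP => ?; apply: h'; exists n.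
have [x x0 hx] := side d (or_introl erefl).
have [y y0 hy] := side (refl d) (or_intror erefl).
have xy0 : 0 < Num.min x y by rewrite lt_min x0.
have [t [n [[dn ->]|[dn ->]]]] := sup1 _ xy0.
  have minx : Num.min x y <= x by rewrite ge_min lexx.
  by have := hx _ dn; lra.
have := hy n; rewrite refl_ltM => /(_ dn).
have miny : Num.min x y <= y by rewrite ge_min lexx orbT.
lra.
Qed.

(** A return through reflection becomes a period when it is made twice. *)
Lemma admissible_self_periodic e : admissible_tail e e ->
  exists b, shift b.+1 e = e.
Proof.
move=> [n [[_ eE]|[_ eE]]]; first by exists n.
exists (n.+1 + n)%N; rewrite -addnS -shift_shift.
have -> : shift n.+1 e = refl e by rewrite {2}eE refl_shift reflK.
by rewrite -eE.
Qed.

Theorem univoque_jump_periodic (P Q : R) d : 1 < P -> P <= Q -> Q < M%:R + 1 ->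
  (forall p, P <= p <= Q -> ~ closure (univoque_bases M (1 : R)) p) ->
  univoque Q d -> ~ univoque P d -> exists a b, shift (a + b.+1) d = shift a d.
Proof.
move=> P1 PQ QM hU uQ nuP.
have [s [PsQ wd sup1]] := critical_base P1 PQ uQ nuP.
have /andP[Ps sQ] := PsQ; have s1 : 1 < s by lra. have sM : s < M%:R + 1 by lra.
have [e [we e1 elim]] := quasi_greedy_limit s1 sM wd sup1.
have nU := hU _ PsQ.
have ee : admissible_tail e e.
  by apply: (quasi_greedy_self_tail s1) => // /subset_closure.
(* If [e] is self-reflecting, isolation makes a tail of [d] with a long common prefix equal to [e].
   Otherwise, were [e] not a tail, univoque bases of [1] would accumulate at [s]. *)
have de : admissible_tail d e.
  have [sr|nsr] := pselect (self_reflecting e).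
    have [n iso] := self_reflecting_isolated s1 sM we e1 sr.
    have [t dt te] := elim n; rewrite -(iso t) //; first exact: weakly_univoque_tail dt.
    exact: wd.
  have [k [[ek eE]|[ek eE]]] := ee; last by case: nsr; exists k.
  apply: contrapT => nde; have [c cd csup] := weakly_univoque_approx_side sup1.
  have wc : weakly_univoque s c.
    by case: cd => ->//; exact: weakly_univoque_refl.
  have nce : ~ admissible_tail c e.
    by case: cd => ->// /admissible_tail_refl.
  apply: nU => B /nbhs_ballP[theta /= theta0 hB].
  have [p ptheta pU] := univoque_base_below s1 sM we e1 ek (esym eE) nsr wc nce csup theta0.
  exists p; split=> //; apply: hB; rewrite /ball /=.
  by rewrite ger0_norm; move: ptheta => /andP[]; lra.
have [b eb] := admissible_self_periodic ee.
have [a [[_ ae]|[_ ae]]] := de; exists a.+1, b; rewrite -shift_shift.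
  by rewrite -ae eb.
have -> : shift a.+1 d = refl e by rewrite ae refl_shift reflK.
by rewrite -refl_shift eb.
Qed.

End Gap.

(** * Hausdorff null sets *)

Section HausdorffNull.
Context {R : realType}.
Implicit Types (A B : set R) (U : nat -> set R) (r s t : R).

Lemma diam_le A r : 0 <= r -> (forall x y, A x -> A y -> `|x - y| <= r) ->
  (diam A <= r%:E)%E.
Proof.
move=> r0 h; apply: ge_ereal_sup => _ [->|[x Ax [y Ay <-]]]; first by rewrite lee_fin.
by rewrite lee_fin h.
Qed.

Lemma diam_ub A x y : A x -> A y -> (`|x - y|%:E <= diam A)%E.
Proof. by move=> Ax Ay; apply: ereal_sup_ubound; right; exists x => //; exists y. Qed.

Lemma diam_ge0 A : (0 <= diam A)%E.
Proof. by apply: ereal_sup_ubound; left. Qed.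

Lemma hweight_ge0 s A : (0 <= hweight s A)%E.
Proof. by rewrite /hweight; case: ifP => // _; exact: poweR_ge0. Qed.

Lemma hweight_le t A r : 0 <= t -> 0 <= r ->
  (forall x y, A x -> A y -> `|x - y| <= r) -> (hweight t A <= (r `^ t)%:E)%E.
Proof.
move=> t0 r0 h; rewrite /hweight; case: ifP => _; first by rewrite lee_fin powR_ge0.
rewrite -poweR_EFin; apply: gt0_ler_poweR => //.
- by rewrite in_itv /= diam_ge0 leey.
- by rewrite in_itv /= lee_fin r0 leey.
- exact: diam_le.
Qed.

Lemma hweight_ub s A x y : 0 <= s -> A x -> A y ->
  ((`|x - y| `^ s)%:E <= hweight s A)%E.
Proof.
move=> s0 Ax Ay; rewrite /hweight; case: ifPn => [/eqP A0|_].
  by rewrite A0 in Ax.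
rewrite -poweR_EFin; apply: gt0_ler_poweR => //.
- by rewrite in_itv /= lee_fin normr_ge0 leey.
- by rewrite in_itv /= diam_ge0 leey.
- exact: diam_ub.
Qed.

(** No bound on diameters is imposed: for a positive exponent, a small total weight already makes
    every piece small. *)
Definition hausdorff_null s A := forall eta : R, 0 < eta ->
  exists2 U, A `<=` \bigcup_i U i &
    (\sum_(0 <= i <oo) hweight s (U i) <= eta%:E)%E.

Lemma hausdorff_null_subset s A B : A `<=` B -> hausdorff_null s B -> hausdorff_null s A.
Proof. by move=> AB h eta /h[U BU hU]; exists U => // x /AB /BU. Qed.

Lemma hausdorff_measure0_null s A : hausdorff_measure s A = 0%E -> hausdorff_null s A.
Proof.
move=> A0 eta eta0.
have : (hausdorff_premeasure s 1 A < eta%:E)%E.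
  apply: le_lt_trans (_ : (_ <= 0)%E) _; last by rewrite lte_fin.
  by rewrite -A0; apply: ereal_sup_ubound; exists 1 => //=.
move=> /ereal_inf_lt[_ [U [AU _] <-]] /ltW hU; by exists U.
Qed.

Lemma hausdorff_measure_ge0 s A : (0 <= hausdorff_measure s A)%E.
Proof.
apply: (@le_trans _ _ (hausdorff_premeasure s 1 A)).
  apply: le_ereal_inf_tmp => _ [U _ <-]; apply: nneseries_ge0 => i _ _.
  exact: hweight_ge0.
by apply: ereal_sup_ubound; exists 1 => //=.
Qed.

Lemma hausdorff_null_measure0 t A : 0 < t -> hausdorff_null t A ->
  hausdorff_measure t A = 0%E.
Proof.
move=> t0 h; apply/eqP; rewrite eq_le hausdorff_measure_ge0 andbT.
apply: ge_ereal_sup => _ [e /= e0 <-]; apply/lee_addgt0Pr => eta eta0; rewrite add0e.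
pose eta' := Num.min eta (e `^ t).
have eta'0 : 0 < eta' by rewrite lt_min eta0 powR_gt0.
have [U AU hU] := h _ eta'0.
apply: (@le_trans _ _ eta'%:E); last by rewrite lee_fin ge_min lexx.
apply: (@le_trans _ _ (\sum_(0 <= i <oo) hweight t (U i))%E _ _ _ hU).
apply: ereal_inf_lbound; exists U => //; split=> // i.
apply: diam_le => [|x y Ux Uy]; first exact: ltW.
have : (hweight t (U i) <= eta'%:E)%E.
  apply: (le_trans _ hU); apply: le_trans (_ : _ <= \sum_(0 <= j < i.+1) hweight t (U j))%E _.
    rewrite big_nat_recr//= leeDr// sume_ge0// => j _; exact: hweight_ge0.
  by apply: nneseries_lim_ge => j _ _; exact: hweight_ge0.
move=> /(le_trans (hweight_ub (ltW t0) Ux Uy)); rewrite lee_fin => hw.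
have {hw} : `|x - y| `^ t <= e `^ t by apply: le_trans hw _; rewrite ge_min lexx orbT.
rewrite leNgt => hw; rewrite leNgt; apply: contra hw => exy.
by apply: gt0_ltr_powR; rewrite ?nnegrE ?normr_ge0 ?(ltW e0).
Qed.

Lemma hausdorff_nullU s A B : hausdorff_null s A -> hausdorff_null s B ->
  hausdorff_null s (A `|` B).
Proof.
move=> hA hB eta eta0; have e2 : 0 < eta / 2 by lra.
have [U AU hU] := hA _ e2; have [V BV hV] := hB _ e2.
pose W n := if odd n then V n./2 else U n./2.
exists W.
  move=> x [/AU[i _ Ux]|/BV[i _ Vx]].
    by exists i.*2 => //; rewrite /W odd_double doubleK.
  by exists i.*2.+1 => //; rewrite /W /= odd_double uphalf_double.
have W0 i : (0 <= hweight s (W i))%E by exact: hweight_ge0.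
apply: lime_le; first exact: is_cvg_nneseries.
apply: nearW => n; apply: (@le_trans _ _ (\sum_(0 <= i < n.*2) hweight s (W i))%E).
  by apply: (lee_sum_nneg_natr _ xpredT) => //; rewrite -addnn leq_addr.
have -> : (\sum_(0 <= i < n.*2) hweight s (W i) =
  \sum_(0 <= i < n) hweight s (U i) + \sum_(0 <= i < n) hweight s (V i))%E.
  elim: n => [|n IH]; first by rewrite !big_nil adde0.
  rewrite doubleS !big_nat_recr//= IH /W /= odd_double uphalf_double doubleK.
  by rewrite -!addeA; congr (_ + _)%E; rewrite addeCA.
rewrite [eta]splitr EFinD leeD//.
  by apply: le_trans hU; apply: nneseries_lim_ge => j _ _; exact: hweight_ge0.
by apply: le_trans hV; apply: nneseries_lim_ge => j _ _; exact: hweight_ge0.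
Qed.

Lemma hausdorff_null_countable t U : 0 < t ->
  (forall i x y, U i x -> U i y -> x = y) -> hausdorff_null t (\bigcup_i U i).
Proof.
move=> t0 h eta eta0; exists U => //; rewrite eseries0 ?lee_fin ?ltW// => i _ _.
apply/eqP; rewrite eq_le hweight_ge0 andbT.
rewrite (_ : 0%E = (0 `^ t)%:E); last by rewrite powR0// gt_eqF.
by apply: hweight_le => //; [exact: ltW|move=> x y /h Ux /Ux ->; rewrite subrr normr0].
Qed.

(** Covers of [B] are pulled back along [G]. A relation instead of a map lets one correspondence be
    used in both directions. *)
Lemma hausdorff_null_hoelder s t K A B (G : R -> R -> Prop) : 0 <= s -> 0 < t -> 0 < K ->
  (forall a, A a -> exists2 b, B b & G a b) ->
  (forall a1 b1 a2 b2, G a1 b1 -> G a2 b2 -> `|a1 - a2| `^ t <= K * `|b1 - b2| `^ s) ->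
  hausdorff_null s B -> hausdorff_null t A.
Proof.
move=> s0 t0 K0 AG hG hB eta eta0.
have eK : 0 < eta / K by rewrite divr_gt0.
have [U BU hU] := hB _ eK.
pose V i := [set a | exists2 b, U i b & G a b].
exists V.
  by move=> a /AG[b /BU[i _ Ub] Gab]; exists i => //; exists b.
apply: le_trans (_ : _ <= K%:E * (eta / K)%:E)%E _; last first.
  by rewrite -EFinM lee_fin mulrC divfK// gt_eqF.
apply: le_trans (_ : _ <= K%:E * \sum_(0 <= i <oo) hweight s (U i))%E _; last first.
  by apply: lee_wpmul2l => //; rewrite lee_fin ltW.
rewrite -nneseriesZl => [|i _]; last exact: hweight_ge0.
apply: lee_nneseries => [i _ _|i _]; first exact: hweight_ge0.
case E : (hweight s (U i)) => [w| |].
- have w0 : 0 <= w by rewrite -lee_fin -E hweight_ge0.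
  have Kw0 : 0 <= K * w by rewrite mulr_ge0// ltW.
  rewrite -EFinM (_ : K * w = (K * w) `^ t^-1 `^ t); last first.
    by rewrite -powRrM mulVf ?gt_eqF// powRr1.
  apply: hweight_le; [exact: ltW|exact: powR_ge0|move=> a1 a2 [b1 Ub1 G1] [b2 Ub2 G2]].
  have : `|a1 - a2| `^ t <= K * w.
    apply: le_trans (hG _ _ _ _ G1 G2) _; rewrite ler_pM2l//.
    by rewrite -lee_fin -E; apply: hweight_ub.
  move=> /(ge0_ler_powR (_ : 0 <= t^-1)); rewrite -powRrM mulfV ?gt_eqF// powRr1//.
  by apply; rewrite ?nnegrE ?powR_ge0 ?invr_ge0// ltW.
- by rewrite gt0_muley ?lte_fin// leey.
- by have := hweight_ge0 s (U i); rewrite E.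
Qed.

Lemma hausdorff_dim_ltP A t : (hausdorff_dim A < t%:E)%E ->
  exists2 s, 0 <= s < t & hausdorff_null s A.
Proof.
move=> /ereal_inf_lt[_ [s [s0 hs] <-]]; rewrite lte_fin => st.
by exists s; [rewrite s0|exact: hausdorff_measure0_null].
Qed.

Lemma hausdorff_dim_le A t : 0 < t -> hausdorff_null t A -> (hausdorff_dim A <= t%:E)%E.
Proof.
move=> t0 h; apply: ereal_inf_lbound; exists t => //; split; first exact: ltW.
exact: hausdorff_null_measure0.
Qed.

Lemma le_hausdorff_dim A B : A `<=` B -> (hausdorff_dim A <= hausdorff_dim B)%E.
Proof.
move=> AB; apply: ereal_inf_le_tmp => _ [s [s0 hs] <-]; exists s => //; split=> //.
apply/eqP; rewrite eq_le hausdorff_measure_ge0 andbT -hs.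
apply: ge_ereal_sup => _ [e /= e0 <-].
apply: (@le_trans _ _ (hausdorff_premeasure s e B)); last first.
  by apply: ereal_sup_ubound; exists e.
apply: ereal_inf_le_tmp => _ [U [BU hU] <-]; exists U => //; split=> // x Ax.
exact/BU/AB.
Qed.

(** The dimension is nondecreasing in [delta], so the limit is an infimum, and comparing two limits
    means comparing two infima. *)
Lemma hausdorff_dim_at_right A (a : R) :
  hausdorff_dim (A `&` `]a - delta, a + delta[) @[delta --> 0^'+] -->
  ereal_inf [set hausdorff_dim (A `&` `]a - delta, a + delta[) |
    delta in [set delta : R | 0 < delta]].
Proof.
have -> : [set delta : R | 0 < delta] = [set` `]0, +oo[ ].
  by apply/seteqP; split=> x /=; rewrite in_itv /= andbT.
apply: nondecreasing_at_right_cvge => // x y _ _ xy.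
apply: le_hausdorff_dim => z [Az /=]; rewrite in_itv /= => /andP[z1 z2].
by split=> //=; rewrite in_itv /=; apply/andP; split; lra.
Qed.

Lemma lee_gt_real (x y : \bar R) : (forall r : R, (y < r%:E)%E -> (x <= r%:E)%E) -> (x <= y)%E.
Proof.
case: y => [y| |] h; last 2 first.
- exact: leey.
- case: x h => [x| |] h //; last by have := h 0; rewrite ltNyr => /(_ isT).
  have /h : (-oo < (x - 1)%:E)%E by rewrite ltNyr.
  by rewrite lee_fin leNgt ltrBlDr ltrDl ltr01.
by apply/lee_addgt0Pr => e e0; rewrite -EFinD; apply: h; rewrite lte_fin ltrDl.
Qed.

End HausdorffNull.

(** * Comparison of bases and points *)

Section Comparison.
Context {R : realType} {M : nat}.
Implicit Types (p q x y : R) (d : nat -> 'I_M.+1).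

Definition eventually_periodic d := exists a b, shift (a + b.+1) d = shift a d.

Lemma eventually_periodic_enum : exists u : nat -> nat -> 'I_M.+1,
  forall d, eventually_periodic d -> exists i, u i = d.
Proof.
(* The code consists of the preperiod, the period less one, and the initial word covering both. *)
pose v (z : nat * nat * seq 'I_M.+1) := let: (a, b, w) := z in
  fun j => nth ord0 w (if (j < a)%N then j else a + (j - a) %% b.+1)%N.
exists (fun i => if unpickle i is Some z then v z else fun=> ord0).
move=> d [a [b dab]]; pose w := mkseq d (a + b.+1).
exists (pickle (a, b, w)); rewrite pickleK; apply/funext => j /=.
case: ltnP => [ja|aj]; first by rewrite nth_mkseq// ltn_addr.
rewrite nth_mkseq ?ltn_add2l ?ltn_pmod//.
have da : (fun n => d (a + n %% b.+1)%N) = shift a d.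
  apply: (@periodic_eq _ _ _ b.+1) => //.
  - by apply/funext => n; rewrite /shift modnDl.
  - by rewrite shift_shift.
  - by move=> n nb; rewrite modn_small.
by rewrite -[RHS](congr1 (fun k => d k) (subnKC aj)) -[RHS]/(shift a d _) -da.
Qed.

Lemma hoelder_bound (s t a b C c X Y : R) n : 0 <= s -> 0 < t -> 1 < a -> 1 < b ->
  0 < C -> 0 < c -> b `^ s <= a `^ t -> 0 <= X -> 0 <= Y ->
  X * a ^+ n <= C -> c <= Y * b ^+ n -> X `^ t <= C `^ t / c `^ s * Y `^ s.
Proof.
move=> s0 t0 a1 b1 C0 c0 bsat X0 Y0 XC cY.
have powX (z r : R) : 1 < z -> (z ^+ n) `^ r = (z `^ r) ^+ n.
  move=> z1; rewrite -powR_mulrn; last lra.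
  by rewrite -powRrM mulrC powRrM powR_mulrn ?powR_ge0.
have XCt : X `^ t * (a `^ t) ^+ n <= C `^ t.
  rewrite -powX// -powRM ?exprn_ge0//; last lra.
  by apply: ge0_ler_powR; rewrite ?nnegrE ?mulr_ge0 ?exprn_ge0//; lra.
have cYs : c `^ s <= Y `^ s * (b `^ s) ^+ n.
  rewrite -powX// -powRM ?exprn_ge0//; last lra.
  by apply: ge0_ler_powR; rewrite ?nnegrE ?mulr_ge0 ?exprn_ge0//; lra.
rewrite mulrAC ler_pdivlMr ?powR_gt0//.
apply: (@le_trans _ _ (X `^ t * (Y `^ s * (b `^ s) ^+ n))).
  by rewrite ler_wpM2l ?powR_ge0.
apply: (@le_trans _ _ (Y `^ s * (X `^ t * (a `^ t) ^+ n))).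
  rewrite mulrCA ler_wpM2l ?powR_ge0// ler_wpM2l ?powR_ge0//.
  by rewrite lerXn2r ?nnegrE ?powR_ge0.
by rewrite mulrC ler_wpM2r ?powR_ge0.
Qed.

Lemma powR_lt_exponent (q u v : R) : 1 < q -> u < v -> q `^ u < q `^ v.
Proof.
move=> q1 uv; rewrite /powR gt_eqF; last lra.
by rewrite ltr_expR ltr_pM2r// ln_gt0.
Qed.

(* With [a = q `^ (2 * s / (s + t))] and [b = q `^ (2 * t / (s + t))] one has
   [a < q < b] and [b `^ s = a `^ t]. *)
Lemma powR_exponent_gap (q s t : R) : 1 < q -> 0 <= s -> s < t ->
  exists2 delta : R, 0 < delta & forall a b, 1 < a -> q - delta <= a -> 1 < b ->
    b <= q + delta -> b `^ s <= a `^ t.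
Proof.
move=> q1 s0 st.
have st0 : 0 < s + t by lra.
have [A [B [A0 Aq qB BA]]] : exists A B, [/\ 0 < A, A < q, q < B & B `^ s = A `^ t].
  exists (q `^ (2 * s / (s + t))), (q `^ (2 * t / (s + t))); split.
  - exact: powR_gt0 (lt_trans ltr01 q1).
  - rewrite -[ltRHS]powRr1 ?ltW// ?(lt_trans ltr01)// powR_lt_exponent//.
    by rewrite ltr_pdivrMr//; lra.
  - rewrite -[ltLHS]powRr1 ?ltW// ?(lt_trans ltr01)// powR_lt_exponent//.
    by rewrite ltr_pdivlMr//; lra.
  - by rewrite -!powRrM; congr (_ `^ _); ring.
exists (Num.min (q - A) (B - q)); first by rewrite lt_min !subr_gt0 Aq.
have m1 : Num.min (q - A) (B - q) <= q - A by rewrite ge_min lexx.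
have m2 : Num.min (q - A) (B - q) <= B - q by rewrite ge_min lexx orbT.
move=> a b a1 qa b1 bq; apply: (@le_trans _ _ (B `^ s)).
  by apply: ge0_ler_powR; rewrite ?nnegrE//; lra.
by rewrite BA; apply: ge0_ler_powR; rewrite ?nnegrE//; lra.
Qed.

(** A converse to [ev_lipschitz]: it bounds a distance of bases by a distance of values. *)
Lemma ev_base_gap p p' d : 1 < p -> p <= p' ->
  ev p d * (p' - p) <= p' * (ev p d - ev p' d).
Proof. by move=> p1 pp'; have := ler_ev d p1 pp'; lra. Qed.

Lemma ev_base_inj p p' d : 1 < p -> 1 < p' -> 0 < ev p d -> ev p d = ev p' d -> p = p'.
Proof.
wlog pp' : p p' / p <= p' => [wl p1 p'1 e0 e|p1 p'1 e0 e].
  have [pp'|/ltW pp'] := leP p p'; first exact: wl.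
  by apply/esym/wl => //; rewrite -e.
by have := ev_base_gap d p1 pp'; rewrite e subrr mulr0 -e; nra.
Qed.

Lemma top_anti p p' : 1 < p -> p <= p' -> top M p' <= top M p :> R.
Proof.
move=> p1 pp'; rewrite /top ler_wpM2l ?ler0n// lef_pV2 ?posrE; lra.
Qed.

(* The implicit function [p |-> ev q d] with [ev p d = x], on sequences that are
   univoque in base [P]: both gaps are comparable to the [n]-th power of the base. *)
Lemma base_point_gap (P Q q x : R) : 1 < P -> Q < M%:R + 1 -> 0 < x -> P <= q <= Q ->
  exists2 C : R, 0 < C & exists2 c : R, 0 < c &
  forall (p1 p2 a b : R) d1 d2, P <= a -> a <= p1 <= b -> a <= p2 <= b -> a <= q <= b ->
    b <= Q -> univoque P d1 -> univoque P d2 -> ev p1 d1 = x -> ev p2 d2 = x ->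
    d1 <> d2 -> exists n, [/\ `|p1 - p2| * a ^+ n <= C, c <= `|p1 - p2| * b ^+ n,
      `|ev q d1 - ev q d2| * a ^+ n <= C & c <= `|ev q d1 - ev q d2| * b ^+ n].
Proof.
move=> P1 QM x0 /andP[Pq qQ].
have PQ : P <= Q by lra.
have Q1 : 1 < Q by lra.
have tQ := top_gt1 Q1 QM; have tP := top_anti P1 PQ.
pose L := M%:R / (P - 1) ^+ 2 + 1.
have L1 : 1 <= L by rewrite lerDr divr_ge0 ?ler0n// exprn_ge0//; lra.
(* The first entry serves the points, the second the bases; [1 <= L] lets [c] serve both as well. *)
pose C := Num.max (top M P) (Q * top M P / x).
pose c := (top M Q - 1) / Q / L.
have c0 : 0 < c by rewrite !divr_gt0//; lra.
have cL : c <= (top M Q - 1) / Q.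
  by rewrite /c ler_pdivrMr ?ler_peMr// ?divr_ge0//; lra.
exists C; first by rewrite lt_max (_ : 0 < top M P)//; lra.
exists c => //.
move=> p1 p2 a b d1 d2 Pa /andP[ap1 p1b] /andP[ap2 p2b] /andP[aq qb] bQ u1 u2 e1 e2 d12.
have [n [agr dn]] := first_difference d12; exists n.
have upow (p r : R) : 1 < p -> p <= r -> 0 < p ^+ n <= r ^+ n.
  by move=> p0 pr; rewrite exprn_gt0 ?lerXn2r ?nnegrE//; lra.
have uni p d : P <= p -> univoque P d -> weakly_univoque p d.
  by move=> Pp ud; apply: univoqueW; exact: univoque_mono Pp ud.
have sepn p : P <= p -> p <= Q -> (top M Q - 1) / Q <= `|ev p d1 - ev p d2| * p ^+ n.
  move=> Pp pQ; have p0 : 1 < p by lra.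
  have pM : p < M%:R + 1 by lra.
  have := weakly_univoque_sepN p0 pM (uni _ _ Pp u1) (uni _ _ Pp u2) agr dn.
  have pn0 : 0 < p ^+ n by rewrite exprn_gt0//; lra.
  rewrite -(ler_pM2r pn0); apply: le_trans.
  rewrite exprS invfM mulrA divfK ?gt_eqF//.
  have tp := top_anti p0 pQ.
  rewrite ler_pM ?invr_ge0 ?lef_pV2 ?posrE//; lra.
have upn p : P <= p -> p <= Q -> `|ev p d1 - ev p d2| * p ^+ n <= top M P.
  move=> Pp pQ; have p0 : 1 < p by lra.
  rewrite -ler_pdivlMr ?exprn_gt0//; last lra.
  apply: le_trans (ev_agree_le p0 agr) _.
  rewrite ler_wpM2r ?invr_ge0 ?exprn_ge0 ?(top_anti P1)//; lra.
have CP : top M P <= C by rewrite le_max lexx.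
have Cx : Q * top M P / x <= C by rewrite le_max lexx orbT.
have q1 : 1 < q by lra.
have a1 : 1 < a by lra.
have /andP[an0 aqn] := upow a q a1 aq; have /andP[_ qbn] := upow q b q1 qb.
have p2P : P <= p2 by lra.
have p2Q : p2 <= Q by lra.
have p11 : 1 < p1 by lra.
have p21 : 1 < p2 by lra.
have /andP[_ ap2n] := upow a p2 a1 ap2; have /andP[p2n0 p2bn] := upow p2 b p21 p2b.
have s2 := sepn _ p2P p2Q; have t2 := upn _ p2P p2Q.
split.
- apply: le_trans Cx; rewrite ler_pdivlMr//.
  (* Both [ev p1 d1] and [ev p2 d2] are [x], so the gap between the sequences in base [p2] is the
     change of [ev _ d1] from [p1] to [p2]. *)
  have key : x * `|p1 - p2| <= Q * `|ev p2 d1 - ev p2 d2|.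
    have [p12|/ltW p21'] := leP p1 p2.
      have := ev_base_gap d1 p11 p12; rewrite e1 e2 => h.
      rewrite ler0_norm ?subr_le0// opprB; apply: le_trans h _.
      rewrite distrC; apply: ler_pM; rewrite ?e2 ?ler_norm//; first lra.
      by have := ev_anti d1 p11 p12; lra.
    have := ev_base_gap d1 p21 p21'; rewrite e1 e2 => h.
    have h2 := ev_anti d1 p21 p21'; rewrite ger0_norm ?subr_ge0//.
    rewrite e1 in h2; rewrite ger0_norm ?subr_ge0//; nra.
  have : x * `|p1 - p2| * a ^+ n <= Q * top M P.
    have : x * `|p1 - p2| * a ^+ n <= Q * (`|ev p2 d1 - ev p2 d2| * p2 ^+ n).
      rewrite mulrA; by apply: ler_pM => //; rewrite ?mulr_ge0 ?(ltW an0) ?(ltW x0).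
    by move/le_trans; apply; rewrite ler_pM2l//; lra.
  by rewrite -mulrA mulrC.
- have lip := ev_lipschitz d1 P1 (_ : P <= p1) p2P; rewrite e1 in lip.
  have {lip} : `|ev p2 d1 - ev p2 d2| <= L * `|p1 - p2|.
    rewrite e2 distrC; apply: le_trans (lip _) _; first lra.
    by rewrite ler_wpM2r// /L lerDl.
  move=> lip; rewrite /c ler_pdivrMr; last lra.
  apply: le_trans s2 _; rewrite mulrAC.
  by apply: ler_pM; rewrite // ?(ltW p2n0)// mulrC.
- apply: le_trans CP; apply: le_trans (upn q Pq qQ); exact: ler_wpM2l.
- apply: le_trans cL _; apply: le_trans (sepn q Pq qQ) _; exact: ler_wpM2l.
Qed.

End Comparison.

(** * Local dimensions *)

Section LocalDimension.
Context {R : realType} {M : nat}.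
Implicit Types (p q x y : R) (d : nat -> 'I_M.+1).

(** Requiring [d] to be univoque in the lower base [P] makes it univoque in [p] and [q] alike, once
    these are at least [P]. *)
Definition base_point (P q x delta p y : R) := exists d : nat -> 'I_M.+1,
  [/\ univoque P d, ev p d = x, ev q d = y & q - delta <= p <= q + delta].

Lemma base_point_hoelder (P Q q x s t : R) : 1 < P -> Q < M%:R + 1 -> 0 < x ->
  P < q < Q -> 0 <= s -> s < t ->
  exists2 delta : R, 0 < delta & exists2 K : R, 0 < K & forall p1 y1 p2 y2,
    base_point P q x delta p1 y1 -> base_point P q x delta p2 y2 ->
    `|p1 - p2| `^ t <= K * `|y1 - y2| `^ s /\ `|y1 - y2| `^ t <= K * `|p1 - p2| `^ s.
Proof.
move=> P1 QM x0 /andP[Pq qQ] s0 st.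
have q1 : 1 < q by lra.
have t0 : 0 < t by lra.
have [C C0 [c c0 gap]] := @base_point_gap _ M P Q q x P1 QM x0 ltac:(by rewrite !ltW).
have [delta' delta'0 pow] := powR_exponent_gap q1 s0 st.
pose delta := Num.min delta' (Num.min (q - P) (Q - q)).
have delta0 : 0 < delta by rewrite !lt_min delta'0 !subr_gt0 Pq.
have dd' : delta <= delta' by rewrite ge_min lexx.
have dP : delta <= q - P by rewrite !ge_min lexx orbT.
have dQ : delta <= Q - q by rewrite !ge_min lexx !orbT.
clearbody delta.
exists delta => //; exists (C `^ t / c `^ s); first by rewrite divr_gt0 ?powR_gt0.
move=> p1 y1 p2 y2 [d1 [u1 e1 <- b1]] [d2 [u2 e2 <- b2]].
have t0' : t != 0 by rewrite gt_eqF.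
(* Equal sequences have no first difference, but then the bases and the points coincide. *)
have [d12|d12] := pselect (d1 = d2).
  have p12 : p1 = p2.
    case/andP: b1 => b1 _; case/andP: b2 => b2 _.
    apply: (@ev_base_inj _ _ _ _ d1); rewrite ?e1//; first lra; first lra.
    by rewrite d12 e2.
  rewrite d12 p12 !subrr normr0 powR0//.
  by split; rewrite mulr_ge0 ?powR_ge0// divr_ge0 ?powR_ge0.
have a1 : 1 < q - delta by lra.
have bb1 : 1 < q + delta by lra.
have Pa : P <= q - delta by lra.
have bQ : q + delta <= Q by lra.
have ab : q - delta <= q <= q + delta by apply/andP; split; lra.
have aq : q - delta' <= q - delta by lra.
have bq : q + delta <= q + delta' by lra.
have [n [h1 h2 h3 h4]] := gap p1 p2 _ _ d1 d2 Pa b1 b2 ab bQ u1 u2 e1 e2 d12.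
have bsat := pow _ _ a1 aq bb1 bq.
by split; apply: (hoelder_bound s0 t0 a1 bb1 C0 c0 bsat _ _ _ _ (n := n)).
Qed.

(* [P] and [Q] lie in the same component of the complement of the closure as [q], so that
   the univoque sequences in two of these bases differ by eventually periodic ones. *)
Lemma univoque_or_periodic (P Q p : R) d : 1 < P -> Q < M%:R + 1 ->
  (forall r, P <= r <= Q -> ~ closure (univoque_bases M (1 : R)) r) ->
  P <= p <= Q -> univoque p d -> univoque P d \/ eventually_periodic d.
Proof.
move=> P1 QM hU /andP[Pp pQ] ud; have [uP|nuP] := pselect (univoque P d); first by left.
right; apply: univoque_jump_periodic P1 Pp _ _ ud nuP; first lra.
by move=> r /andP[Pr rp]; apply: hU; rewrite Pr (le_trans rp).
Qed.

(** Sequences univoque in base [P] are handled by the Hoelder correspondence. The others are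
    eventually periodic, and each of these takes the value [x] in at most one base. *)
Lemma univoque_bases_null (P Q q x s t eps : R) : 1 < P -> Q < M%:R + 1 -> 0 < x ->
  P < q < Q -> (forall r, P <= r <= Q -> ~ closure (univoque_bases M (1 : R)) r) ->
  0 <= s -> s < t -> 0 < eps ->
  hausdorff_null s (univoque_points M q `&` `]x - eps, x + eps[) ->
  exists2 delta : R, 0 < delta &
    hausdorff_null t (univoque_bases M x `&` `]q - delta, q + delta[).
Proof.
move=> P1 QM x0 PqQ hU s0 st eps0 null.
have [dh dh0 [K K0 hoelder]] := base_point_hoelder P1 QM x0 PqQ s0 st.
have [dc dc0 close] := ev_uniform (M := M) P1 eps0.
have [u uP] := @eventually_periodic_enum M.
case/andP: PqQ => Pq qQ.
pose delta := Num.min (Num.min dh dc) (Num.min (q - P) (Q - q)).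
have delta0 : 0 < delta by rewrite !lt_min dh0 dc0 !subr_gt0 Pq.
have ddh : delta <= dh by rewrite !ge_min lexx.
have ddc : delta <= dc by rewrite !ge_min lexx orbT.
have dP : delta <= q - P by rewrite !ge_min lexx !orbT.
have dQ : delta <= Q - q by rewrite !ge_min lexx !orbT.
clearbody delta; exists delta => //.
pose bad i := [set p : R | 1 < p /\ ev p (u i) = x].
pose good := [set p | `|p - q| < delta /\ exists2 d : nat -> 'I_M.+1,
  univoque P d & ev p d = x].
have t0 : 0 < t by lra.
apply: (@hausdorff_null_subset _ _ _ (good `|` \bigcup_i bad i)).
  clear null hoelder close => p [[/andP[p1 pM] ptx] /=]; rewrite in_itv /= => /andP[pl pr].
  have [d dx ud] := univoque_points_univoque p1 pM ptx.
  have PpQ : P <= p <= Q by apply/andP; split; lra.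
  have [uPd|/uP[i ud']] := univoque_or_periodic P1 QM hU PpQ ud.
    by left; split; [rewrite ltr_norml; apply/andP; split; lra|exists d].
  by right; exists i => //; split; rewrite ?ud'.
apply: hausdorff_nullU; last first.
  apply: hausdorff_null_countable => // i p p' [p1 px] [p'1 p'x].
  by apply: (@ev_base_inj _ _ p p' (u i)); rewrite ?px ?p'x.
apply: (hausdorff_null_hoelder (G := base_point P q x dh) s0 t0 K0 _ _ null).
- clear hU null hoelder u uP bad => p [pq [d ud dx]].
  have pq' : `|q - p| < delta by rewrite distrC.
  move: pq; rewrite ltr_norml => /andP[pl pr].
  have Pp : P <= p by lra.
  have Pq' : P <= q by lra.
  have qpdc : `|q - p| < dc by lra.
  have := close q p d Pq' Pp qpdc; rewrite dx ltr_norml => /andP[yl yr].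
  exists (ev q d).
    split; first by apply: univoque_univoque_points; [lra|exact: univoque_mono ud].
    by rewrite /= in_itv /=; apply/andP; split; lra.
  by exists d; split=> //; apply/andP; split; lra.
- by move=> a1 b1 a2 b2 G1 G2; have [] := hoelder _ _ _ _ G1 G2.
Qed.

Lemma univoque_points_null (P Q q x s t eps : R) : 1 < P -> Q < M%:R + 1 -> 0 < x ->
  P < q < Q -> (forall r, P <= r <= Q -> ~ closure (univoque_bases M (1 : R)) r) ->
  0 <= s -> s < t -> 0 < eps ->
  hausdorff_null s (univoque_bases M x `&` `]q - eps, q + eps[) ->
  exists2 delta : R, 0 < delta &
    hausdorff_null t (univoque_points M q `&` `]x - delta, x + delta[).
Proof.
move=> P1 QM x0 PqQ hU s0 st eps0 null.
have [dh dh0 [K K0 hoelder]] := base_point_hoelder P1 QM x0 PqQ s0 st.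
have [u uP] := @eventually_periodic_enum M.
case/andP: PqQ => Pq qQ.
have q1 : 1 < q by lra.
have q0 : 0 < q by lra.
pose eta := Num.min (Num.min dh (eps / 2)) (Num.min (q - P) (Q - q)).
have eta0 : 0 < eta by rewrite !lt_min dh0 divr_gt0// !subr_gt0 Pq.
have etadh : eta <= dh by rewrite !ge_min lexx.
have etaeps : eta <= eps / 2 by rewrite !ge_min lexx orbT.
have etaP : eta <= q - P by rewrite !ge_min lexx !orbT.
have etaQ : eta <= Q - q by rewrite !ge_min lexx !orbT.
clearbody eta.
(* Within this radius [x * (q - eta) < q * y < x * (q + eta)], so by [ler_ev] a sequence of value
   [y] in base [q] takes the value [x] in a base within [eta] of [q]. *)
exists (x * eta / q); first by rewrite divr_gt0 ?mulr_gt0.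
pose bad i := [set ev q (u i)].
pose good := [set y | `|y - x| < x * eta / q /\ exists2 d : nat -> 'I_M.+1,
  univoque P d & ev q d = y].
have t0 : 0 < t by lra.
apply: (@hausdorff_null_subset _ _ _ (good `|` \bigcup_i bad i)).
  clear null hoelder => y [ypt /=]; rewrite in_itv /= => /andP[yl yr].
  have qM : q <= M%:R + 1 by lra.
  have [d dy ud] := univoque_points_univoque q1 qM ypt.
  have PqQ : P <= q <= Q by apply/andP; split; lra.
  have [uPd|/uP[i ud']] := univoque_or_periodic P1 QM hU PqQ ud.
    by left; split; [rewrite ltr_norml; apply/andP; split; lra|exists d].
  by right; exists i => //; rewrite /bad /= ud'.
apply: hausdorff_nullU; last first.
  by apply: hausdorff_null_countable => // i p p' -> ->.
apply: (hausdorff_null_hoelder (G := fun y p => base_point P q x dh p y) s0 t0 K0 _ _ null).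
- clear hU null hoelder u uP bad => y [yx [d ud dy]].
  have : `|y - x| * q < x * eta by rewrite -ltr_pdivlMr.
  rewrite -[X in _ * X](ger0_norm (ltW q0)) -normrM ltr_norml => /andP[yl yr].
  have a1 : 1 < q - eta by lra.
  have lo : x <= ev (q - eta) d.
    have := @ler_ev _ _ (q - eta) q d a1; rewrite dy => /(_ ltac:(lra)) h.
    by rewrite -(ler_pM2l (_ : 0 < q - eta)); lra.
  have hi : ev (q + eta) d <= x.
    have := @ler_ev _ _ q (q + eta) d q1; rewrite dy => /(_ ltac:(lra)) h.
    by rewrite -(ler_pM2l (_ : 0 < q + eta)); lra.
  have ab : q - eta <= q + eta by lra.
  have [p /andP[pl pr] px] := ev_IVT a1 ab hi lo.
  exists p.
    split.
      split; first by apply/andP; split; lra.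
      by rewrite -px; apply: univoque_univoque_points; [lra|apply: univoque_mono ud; lra].
    by rewrite /= in_itv /=; apply/andP; split; lra.
  by exists d; split=> //; apply/andP; split; lra.
- by move=> a1 b1 a2 b2 G1 G2; have [] := hoelder _ _ _ _ G1 G2.
Qed.

(** The constant sequence [M] has value [1] here, and its admissible tails, all reflected, have
    value [0]. Hence a base off the closure has room above it. *)
Lemma univoque_max_base : (1 <= M)%N -> univoque_bases M 1 (M%:R + 1 : R).
Proof.
move=> M1; have M0 : 0 < M%:R :> R by rewrite ltr0n.
have p1 : 1 < M%:R + 1 :> R by lra.
have e1 : ev (M%:R + 1 : R) (fun=> (ord_max : 'I_M.+1)) = 1.
  by apply: (@ev_orbit _ _ _ _ (fun=> 1) 1) => // n; rewrite ?normr1//= mulr1.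
apply: (univoque_bases1 p1 (lexx _) _ e1) => t [n [[/=]|[_ ->]]]; first by rewrite ltnn.
rewrite -refl_shift ev_refl// [X in _ - X]e1 /top addrK divff ?gt_eqF//; lra.
Qed.

End LocalDimension.

Theorem theorem1p1 (R : realType) (M : nat) (hM : (1 <= M)%N) (x q : R)
    (hx : 0 < x) (hq : 1 < q <= max_base M x)
    (hqU : ~ closure (univoque_bases M 1) q) :
  exists l : \bar R,
    hausdorff_dim (univoque_bases M x `&` `]q - delta, q + delta[)
      @[delta --> 0^'+] --> l /\
    hausdorff_dim (univoque_points M q `&` `]x - delta, x + delta[)
      @[delta --> 0^'+] --> l.
Proof.
case/andP: hq => q1; rewrite /max_base le_min => /andP[qM _].
have {}qM : q < M%:R + 1.
  rewrite lt_neqAle [M%:R + 1]addrC qM andbT; apply/eqP => qE; apply: hqU.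
  by rewrite qE addrC; apply: subset_closure; exact: univoque_max_base.
have /nbhs_ballP[theta /= theta0 hball] : nbhs q (~` closure (univoque_bases M 1)).
  by apply: open_nbhs_nbhs; split=> //; apply: closed_openC; exact: closed_closure.
pose eta := Num.min theta (Num.min (q - 1) (M%:R + 1 - q)) / 2.
have m0 : 0 < Num.min theta (Num.min (q - 1) (M%:R + 1 - q)).
  by rewrite !lt_min theta0 !subr_gt0 q1.
have eta2 : 2 * eta = Num.min theta (Num.min (q - 1) (M%:R + 1 - q)) by rewrite /eta; field.
have etat : 2 * eta <= theta by rewrite eta2 !ge_min lexx.
have eta1 : 2 * eta <= q - 1 by rewrite eta2 !ge_min lexx !orbT.
have etaM : 2 * eta <= M%:R + 1 - q by rewrite eta2 !ge_min lexx !orbT.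
have eta0 : 0 < eta by rewrite divr_gt0.
clearbody eta => {eta2 m0}.
have P1 : 1 < q - eta by lra.
have QM : q + eta < M%:R + 1 by lra.
have PqQ : q - eta < q < q + eta by apply/andP; split; lra.
have hU r : q - eta <= r <= q + eta -> ~ closure (univoque_bases M 1) r.
  move=> /andP[rl rr]; apply: hball; rewrite /ball /= ltr_norml.
  by apply/andP; split; lra.
exists (ereal_inf [set hausdorff_dim (univoque_bases M x `&` `]q - delta, q + delta[) |
  delta in [set delta : R | 0 < delta]]).
split; first exact: hausdorff_dim_at_right.
set l1 := ereal_inf _.
rewrite (_ : l1 = ereal_inf [set hausdorff_dim (univoque_points M q `&`
    `]x - delta, x + delta[) | delta in [set delta : R | 0 < delta]]).
  exact: hausdorff_dim_at_right.
(* A dimension below [t] on one side provides a null exponent [s < t], and the transfer with this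
   loss of exponent bounds a local dimension on the other side by [t]. *)
apply/eqP; rewrite eq_le; apply/andP; split.
- apply: lee_gt_real => t /ereal_inf_lt[_ [eps /= eps0 <-]].
  move=> /hausdorff_dim_ltP[s /andP[s0 st] null].
  have [delta delta0 hnull] := univoque_bases_null P1 QM hx PqQ hU s0 st eps0 null.
  apply: le_trans (hausdorff_dim_le (le_lt_trans s0 st) hnull).
  by apply: ereal_inf_lbound; exists delta.
- apply: lee_gt_real => t /ereal_inf_lt[_ [eps /= eps0 <-]].
  move=> /hausdorff_dim_ltP[s /andP[s0 st] null].
  have [delta delta0 hnull] := univoque_points_null P1 QM hx PqQ hU s0 st eps0 null.
  apply: le_trans (hausdorff_dim_le (le_lt_trans s0 st) hnull).
  by apply: ereal_inf_lbound; exists delta.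
Qed.
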